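(* The following two identities hold: \begin{align*} \sum_{i,j,k\geq 0} \frac{q^{2i^2+j^2+k^2-2ij-jk+2i-j}}{(q^2;q^2)_{2i}(q^2;q^2)_j(q^2;q^2)_{k}}&=3\frac{J_3^3\overline{J}_{4,12}}{J_1J_2^2J_6}, \\ \sum_{i,j,k\geq 0} \frac{q^{2i^2+j^2+k^2-2ij-jk+4i-2j+1}}{(q^2;q^2)_{2i+1}(q^2;q^2)_j(q^2;q^2)_{k}}&=3\frac{J_3^3\overline{J}_{2,12}}{J_1J_2^2J_6}. \end{align*}
   Context: Throughout $|q|<1$. Notation: $(a;q)_n=\prod_{k=0}^{n-1}(1-aq^k)$, $(a;q)_\infty=\prod_{k\ge0}(1-aq^k)$, $(a_1,\dots,a_r;q)_\infty=\prod_s(a_s;q)_\infty$; $J_m:=(q^m;q^m)_\infty$ and $\overline{J}_{a,m}:=(-q^a,-q^{m-a},q^m;q^m)_\infty$. *)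

(* Defs.v *)
From mathcomp Require Export all_boot all_order all_algebra.
From mathcomp Require Export finmap.
From mathcomp Require Export all_classical all_reals all_analysis.
From mathcomp Require Export complex.
From mathcomp.analysis.showcase Require Export summability.
Export Order.TTheory GRing.Theory Num.Theory numFieldNormedType.Exports.

Set Implicit Arguments.
Unset Strict Implicit.
Unset Printing Implicit Defensive.

Local Open Scope classical_set_scope.
Local Open Scope ring_scope.

Definition qpoch (K : numFieldType) (a q : K) (n : nat) : K :=
  \prod_(0 <= k < n) (1 - a * q ^+ k).

Definition qpoch_inf (K : numFieldType) (a q : K) : K :=
  lim (qpoch a q @ \oo).

Definition qpochs_inf (K : numFieldType) (s : seq K) (q : K) : K :=
  \prod_(a <- s) qpoch_inf a q.

Definition J (K : numFieldType) (q : K) (m : nat) : K :=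
  qpoch_inf (q ^+ m) (q ^+ m).

Definition Jbar (K : numFieldType) (q : K) (a m : nat) : K :=
  qpochs_inf [:: - q ^+ a; - q ^ (m%:Z - a%:Z); q ^+ m] (q ^+ m).

(* Unconditional summation: [partial_sum f A] is the sum of [f] over the finite
   set [A], and [totally] is the filter of finite sets ordered by inclusion. *)
Definition has_sum (I : choiceType) (K : numFieldType) (f : I -> K) (l : K) :
  Prop := partial_sum f @ totally --> l.

(* Main.v *)
(** Choose [Q] with [Q ^+ 2 = q], put [p = Q ^+ 4], and let [rho n] be
    [1 / (p; p)_n].  With [n = 2 i] or [n = 2 i + 1], completing squares turns
    the summand, up to a fixed power of [Q], into
    [Q ^ ((n + 1 - j)^2 + (j - k)^2 + k^2) * rho n * rho j * rho k].
    A finite identity of Schur type writes [rho n] as the sum over [r], with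
    [r = n] modulo 2, of
    [(-1)^r * p ^ (r (3 r - 1) / 2) * (1 - p ^ (3 r + 1)) * rho u * rho v],
    where [u + v = n + 1] and [u - v = 3 r + 1].  For fixed [D = u - v] the
    Gaussian kernel then passes along the chain [n, j, k]: the product of
    [(p; p)_oo * rho j] and the sum of [Q ^ ((u + v - j)^2) * rho u * rho v]
    over [u - v = D] is the sum of [Q ^ ((e - f + D)^2) * rho e * rho f] over
    [e + f = j].  Each passage frees one index, and three of them leave
    [(p; p)_oo ^ (-3)] times the sum of [Q ^ (x^2 + y^2 + z^2)] over
    [x + y + z = 3 r + 1].  This is a coset theta series of the lattice A_2;
    up to a power of [Q] it does not depend on [r], and it equals
    [3 J_3^3 / J_1].  The theta series in [r] that remains is evaluated by
    instances of the quintuple product identity. *)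
Require Import Defs.
From mathcomp Require Import zify ring.

Set Implicit Arguments.
Unset Strict Implicit.
Unset Printing Implicit Defensive.

Local Open Scope classical_set_scope.
Local Open Scope ring_scope.

(* [summability] declares this instance inside a section, hence only there. *)
#[local] Existing Instance totally_filter.

(** The obstacle is that n keeps one parity: a Gaussian kernel passes along the chain only from an
    unrestricted sum over pairs with a fixed difference. The expansion of [rho n] removes the
    restriction, because [u + v = n + 1] and [u - v = 3 r + 1] tie the parity of n to that of r; for
    each admissible r the pairs [u, v] are then free. The multiples of 3 are chosen for the end of
    the chain: adding 1 to each of x, y, z moves [x + y + z] by 3, so the differences congruent to 1
    modulo 3 all lead to the same coset of A_2, whose theta series leaves the sum over r as a common
    factor. The square root Q is forced by the halves that appear when squares are completed.
    Exponents are integers of either sign, so Q must be nonzero, and [q = 0] is settled separately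
    by counting the terms with exponent 0. The q-series part is carried out over any [numFieldType]
    in which absolutely summable families have sums; that the complex numbers qualify is shown at
    the end. *)

Ltac qpow := rewrite -?expfzDr //; congr (_ ^ _); ring.

(** * Unconditional sums *)

Definition abs_summable (I : choiceType) (K : numFieldType) (f : I -> K) :=
  exists M : K, forall A : {fset I}, \sum_(i <- A) `|f i| <= M.

(** This assumption also stands in for the archimedean property, which a [numFieldType] may lack;
    see [expr_lt_eps]. *)
Definition abs_complete (K : numFieldType) :=
  forall (I : choiceType) (f : I -> K), abs_summable f -> exists l, has_sum f l.

Definition csum (I : choiceType) (K : numFieldType) (f : I -> K) : K :=
  lim (partial_sum f @ totally).

Section Basics.
Variable K : numFieldType.
Implicit Types I J : choiceType.

Lemma has_sumP I (f : I -> K) (l : K) :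
  has_sum f l <-> forall e, 0 < e -> exists A : {fset I},
    forall B : {fset I}, (A `<=` B)%fset -> `|l - \sum_(i <- B) f i| < e.
Proof.
rewrite /has_sum; split.
  move=> /cvgrPdist_lt h e e0; have [A _ hA] := h e e0.
  exists A => B AB; have := hA B AB.
  by rewrite /partial_sum -(big_seq_fsetE _ _ xpredT).
move=> h; apply/cvgrPdist_lt => e e0; have [A hA] := h e e0.
exists A => // B /= AB; have := hA B AB.
by rewrite /partial_sum -(big_seq_fsetE _ _ xpredT).
Qed.

Lemma has_sum_csum I (f : I -> K) l : has_sum f l -> csum f = l.
Proof. by move=> h; apply: cvg_lim => //; exact: norm_hausdorff. Qed.

Lemma eq_csum I (f g : I -> K) : f =1 g -> csum f = csum g.
Proof. by move=> /funext ->. Qed.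

Lemma has_sumD I (f g : I -> K) l m :
  has_sum f l -> has_sum g m -> has_sum (fun i => f i + g i) (l + m).
Proof.
move=> /has_sumP hf /has_sumP hg; apply/has_sumP => e e0.
have e20 : 0 < e / 2 by rewrite divr_gt0.
have [A hA] := hf _ e20; have [B hB] := hg _ e20.
exists (A `|` B)%fset => S; rewrite fsubUset => /andP[/hA h1 /hB h2].
rewrite big_split /= opprD addrACA (le_lt_trans (ler_normD _ _))//.
by rewrite [e]splitr ltrD.
Qed.

Lemma has_sumZ I (f : I -> K) l c :
  has_sum f l -> has_sum (fun i => c * f i) (c * l).
Proof.
have [->|c0] := eqVneq c 0.
  move=> _; apply/has_sumP => e e0; exists fset0 => B _.
  by rewrite -mulr_sumr !mul0r subrr normr0.
move=> /has_sumP hf; apply/has_sumP => e e0.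
have nc : 0 < `|c| by rewrite normr_gt0.
have [A hA] := hf _ (divr_gt0 e0 nc).
exists A => B /hA; rewrite -mulr_sumr -mulrBr normrM.
by rewrite ltr_pdivlMr // mulrC.
Qed.

Lemma has_sum_sum I (T : Type) (r : seq T) (F : T -> I -> K) (g : T -> K) :
  (forall t, has_sum (F t) (g t)) ->
  has_sum (fun i => \sum_(t <- r) F t i) (\sum_(t <- r) g t).
Proof.
move=> h; elim: r => [|t r IHr].
  apply/has_sumP => e e0; exists fset0 => B _.
  by rewrite big_nil big1 ?subrr ?normr0// => i _; rewrite big_nil.
rewrite big_cons; under eq_fun do rewrite big_cons.
exact: has_sumD.
Qed.

Lemma has_sum_finite I (f : I -> K) (A : {fset I}) :
  (forall i, i \notin A -> f i = 0) -> has_sum f (\sum_(i <- A) f i).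
Proof.
move=> h; apply/has_sumP => e e0; exists A => B AB.
by rewrite (big_fset_incl _ AB) ?subrr ?normr0// => i _ /h.
Qed.

(** Injectivity makes the preimage of [B] finite, and the points of [B] off the image contribute
    zeros. Reindexing of [has_sum] and of [abs_summable] rests on this. *)
Lemma sum_fset_preimage I J (h : I -> J) (f : J -> K) (B : {fset J}) :
  injective h -> (forall j, (forall i, h i != j) -> f j = 0) ->
  exists A : {fset I}, (forall i, (i \in A) = (h i \in B)) /\
    \sum_(j <- B) f j = \sum_(i <- A) f (h i).
Proof.
move=> hi f0; have fin : finite_set (h @^-1` [set` B]).
  by apply: finite_preimage => // x y _ _; apply: hi.
exists (fset_set (h @^-1` [set` B])); set A := fset_set _.
have AB i : (i \in A) = (h i \in B).
  by rewrite in_fset_set// /in_mem/=; apply/idP/idP; rewrite inE.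
split=> //; have sub : ([fset h i | i in A] `<=` B)%fset.
  by apply/fsubsetP => j /imfsetP[i /= iA ->]; rewrite -AB.
rewrite -(big_fset_incl _ sub) ?big_imfset//= => [x y _ _ /hi//|j jB jA].
apply: f0 => i; apply: contraNneq jA => hij.
by apply/imfsetP; exists i; rewrite //= AB hij.
Qed.

Lemma has_sum_inj I J (h : I -> J) (f : J -> K) l : injective h ->
  (forall j, (forall i, h i != j) -> f j = 0) ->
  has_sum (fun i => f (h i)) l <-> has_sum f l.
Proof.
move=> hi f0.
split => /has_sumP H; apply/has_sumP => e e0; have [A hA] := H e e0.
  exists [fset h i | i in A]%fset => B AB.
  have [A' [hA' ->]] := sum_fset_preimage B hi f0; apply: hA; apply/fsubsetP => i iA.
  by rewrite hA'; apply: (fsubsetP AB); apply/imfsetP; exists i.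
have [A' [hA' _]] := sum_fset_preimage A hi f0.
(* [B] contains the preimage [A'] of [A], so the preimage of [B'] is [B] itself. *)
exists A' => B AB; set B' := (A `|` [fset h i | i in B])%fset.
have /hA : (A `<=` B')%fset by apply: fsubsetUl.
have [B'' [hB'' ->]] := sum_fset_preimage B' hi f0.
suff -> : B'' = B by [].
apply/fsetP => i; rewrite hB'' inE; apply/orP/idP.
  case=> [|/imfsetP[j/= jB /hi ->]//].
  by rewrite -hA'; apply: (fsubsetP AB).
by move=> iB; right; apply/imfsetP; exists i.
Qed.

Lemma has_sum_reindex I J (h : I -> J) (f : J -> K) l : bijective h ->
  has_sum (fun i => f (h i)) l <-> has_sum f l.
Proof.
move=> bh; apply: has_sum_inj; first exact: bij_inj.
by case: bh => g hg gh j /(_ (g j)); rewrite gh eqxx.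
Qed.

Lemma abs_summable_le I (f g : I -> K) :
  (forall i, `|f i| <= `|g i|) -> abs_summable g -> abs_summable f.
Proof.
by move=> h [M hM]; exists M => A; apply: le_trans (hM A); apply: ler_sum.
Qed.

Lemma abs_summableD I (f g : I -> K) : abs_summable f -> abs_summable g ->
  abs_summable (fun i => f i + g i).
Proof.
move=> [M hM] [N hN]; exists (M + N) => A.
apply: le_trans (lerD (hM A) (hN A)); rewrite -big_split/=.
by apply: ler_sum => i _; apply: ler_normD.
Qed.

Lemma abs_summableZ I (f : I -> K) c :
  abs_summable f -> abs_summable (fun i => c * f i).
Proof.
move=> [M hM]; exists (`|c| * M) => A.
under eq_bigr do rewrite normrM.
by rewrite -mulr_sumr ler_wpM2l.
Qed.

Lemma abs_summableN I (f : I -> K) :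
  abs_summable f -> abs_summable (fun i => - f i).
Proof. by apply: abs_summable_le => i; rewrite normrN. Qed.

Lemma abs_summableB I (f g : I -> K) : abs_summable f -> abs_summable g ->
  abs_summable (fun i => f i - g i).
Proof. by move=> hf /abs_summableN; apply: abs_summableD. Qed.

Lemma abs_summableM I (f g : I -> K) (M : K) : (forall i, `|f i| <= M) ->
  abs_summable g -> abs_summable (fun i => f i * g i).
Proof.
move=> hf hg; apply: abs_summable_le (abs_summableZ M hg) => i.
by rewrite !normrM ler_wpM2r// (le_trans (hf i))// real_ler_norm// 
  ger0_real// (le_trans _ (hf i)).
Qed.

Lemma abs_summable_inj I J (h : I -> J) (f : J -> K) : injective h ->
  abs_summable f -> abs_summable (fun i => f (h i)).
Proof.
move=> hi [M hM]; exists M => A; apply: le_trans (hM [fset h i | i in A]%fset).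
by rewrite big_imfset//= => x y _ _ /hi.
Qed.

Lemma abs_summable_ext I J (h : I -> J) (f : J -> K) : injective h ->
  (forall j, (forall i, h i != j) -> f j = 0) ->
  abs_summable (fun i => f (h i)) -> abs_summable f.
Proof.
move=> hi f0 [M hM]; exists M => B.
have nf0 j : (forall i, h i != j) -> `|f j| = 0 by move/f0 => ->; rewrite normr0.
by have [A [_ ->]] := sum_fset_preimage B hi nf0.
Qed.

Lemma le_sum_fset I (f : I -> K) (A B : {fset I}) : (forall i, 0 <= f i) ->
  (A `<=` B)%fset -> \sum_(i <- A) f i <= \sum_(i <- B) f i.
Proof.
move=> f0 AB; have -> : \sum_(i <- A) f i = \sum_(i <- A) (if i \in A then f i else 0).
  by apply: eq_big_seq => i ->.
rewrite (big_fset_incl _ AB) => [|i _ /negbTE ->//].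
by apply: ler_sum => i _; case: ifP.
Qed.

Lemma sum_fset_pair_le I J (F : I * J -> K) (A : {fset (I * J)}) :
  (forall x, 0 <= F x) ->
  \sum_(x <- A) F x <= \sum_(i <- [fset x.1 | x in A]%fset)
                         \sum_(j <- [fset x.2 | x in A]%fset) F (i, j).
Proof.
move=> F0; set B := [fset x.1 | x in A]%fset; set C := [fset x.2 | x in A]%fset.
pose s := [seq (i, j) | i <- B, j <- C].
have -> : \sum_(i <- B) \sum_(j <- C) F (i, j) = \sum_(x <- s) F x.
  by rewrite big_allpairs.
have us : uniq s by apply: allpairs_uniq => // -[a b] [c d].
rewrite [leRHS](perm_big [fset x in s]%fset); last first.
  by apply: uniq_perm; rewrite ?fset_uniq// => x; rewrite inE.
apply: le_sum_fset => //; apply/fsubsetP => -[a b] abA; rewrite inE.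
apply/allpairsP; exists (a, b); split => //=.
  by apply/imfsetP; exists (a, b).
by apply/imfsetP; exists (a, b).
Qed.

Lemma abs_summable_iter I J (F : I -> J -> K) (g : I -> K) :
  (forall i (B : {fset J}), \sum_(j <- B) `|F i j| <= g i) ->
  abs_summable g -> abs_summable (fun x => F x.1 x.2).
Proof.
move=> hF [M hM]; exists M => A.
apply: le_trans (sum_fset_pair_le _ _) _ => //=.
apply: le_trans (hM [fset x.1 | x in A]%fset); apply: ler_sum => i _.
apply: le_trans (hF _ _) _; apply: real_ler_norm; apply: ger0_real.
by have := hF i fset0; rewrite big_seq_fset0.
Qed.

Lemma abs_summable_pair I J (f : I -> K) (g : J -> K) :
  abs_summable f -> abs_summable g -> abs_summable (fun x => f x.1 * g x.2).
Proof.
move=> hf [N hN]; apply: (@abs_summable_iter _ _ (fun i j => f i * g j)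
  (fun i => `|f i| * N)) => [i B|].
  under eq_bigr do rewrite normrM.
  by rewrite -mulr_sumr ler_wpM2l.
have N0 : 0 <= N by have := hN fset0; rewrite big_seq_fset0.
have [M hM] := hf; exists (M * N) => A.
under eq_bigr do rewrite normrM normr_id (ger0_norm N0).
by rewrite -mulr_suml ler_wpM2r.
Qed.

(* Testing against rectangles whose second side exhausts [J]. *)
Lemma has_sum_fubini I J (F : I -> J -> K) (g : I -> K) l :
  has_sum (fun x => F x.1 x.2) l -> (forall i, has_sum (F i) (g i)) ->
  has_sum g l.
Proof.
move=> /has_sumP hF hg; apply/has_sumP => e e0.
have e20 : 0 < e / 2 by rewrite divr_gt0.
have [A hA] := hF _ e20.
exists [fset x.1 | x in A]%fset => B AB.
have : has_sum (fun j => \sum_(i <- B) F i j) (\sum_(i <- B) g i).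
  exact: has_sum_sum.
move=> /has_sumP/(_ _ e20)[C hC].
set D := (C `|` [fset x.2 | x in A])%fset.
have h1 := hC D (fsubsetUl _ _).
set s := [seq (i, j) | i <- B, j <- D].
have us : uniq s by apply: allpairs_uniq => // -[a b] [c d].
have sub : (A `<=` [fset x in s])%fset.
  apply/fsubsetP => -[a b] abA; rewrite inE; apply/allpairsP; exists (a, b).
  split => //=; first by apply: (fsubsetP AB); apply/imfsetP; exists (a, b).
  by rewrite inE; apply/orP; right; apply/imfsetP; exists (a, b).
have := hA _ sub.
have -> : \sum_(x <- [fset x in s]%fset) F x.1 x.2
        = \sum_(j <- D) \sum_(i <- B) F i j.
  rewrite exchange_big/= (perm_big s); last first.
    by apply: uniq_perm; rewrite ?fset_uniq// => x; rewrite inE.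
  by rewrite /s big_allpairs.
move=> h2; rewrite -(subrKA (\sum_(j <- D) \sum_(i <- B) F i j)).
rewrite (le_lt_trans (ler_normD _ _))// [e]splitr ltrD// distrC//.
Qed.

End Basics.

Section Complete.
Variable K : numFieldType.
Hypothesis Kc : abs_complete K.
Implicit Types I J : choiceType.

Lemma has_sum_norm_le I (f : I -> K) l (M : K) : has_sum f l ->
  (forall A : {fset I}, `|\sum_(i <- A) f i| <= M) -> `|l| <= M.
Proof.
move=> /has_sumP h hM.
have M0 : 0 <= M by apply: le_trans (hM fset0).
rewrite real_leNgt ?normr_real ?ger0_real//; apply/negP => ltM.
have [|A /(_ A)] := h (`|l| - M); first by rewrite subr_gt0.
rewrite fsubset_refl => /(_ isT) hA.
suff : `|l| < `|l| by rewrite ltxx.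
rewrite -{1}[l](subrK (\sum_(i <- A) f i)) (le_lt_trans (ler_normD _ _))//.
by rewrite -[ltRHS](subrK M) ltr_leD.
Qed.

Lemma csumP I (f : I -> K) : abs_summable f -> has_sum f (csum f).
Proof. by move=> /Kc[l hl]; rewrite (has_sum_csum hl). Qed.

Lemma csumD I (f g : I -> K) : abs_summable f -> abs_summable g ->
  csum (fun i => f i + g i) = csum f + csum g.
Proof. by move=> /csumP hf /csumP hg; apply: has_sum_csum; apply: has_sumD. Qed.

Lemma csumZ I (f : I -> K) c : abs_summable f ->
  csum (fun i => c * f i) = c * csum f.
Proof. by move=> /csumP hf; apply: has_sum_csum; apply: has_sumZ. Qed.

Lemma csumZr I (f : I -> K) c : abs_summable f ->
  csum (fun i => f i * c) = csum f * c.
Proof.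
by move=> hf; rewrite mulrC -csumZ//; apply: eq_csum => i; rewrite mulrC.
Qed.

Lemma csumN I (f : I -> K) : abs_summable f -> csum (fun i => - f i) = - csum f.
Proof.
by move=> hf; rewrite -mulN1r -csumZ//; apply: eq_csum => i; rewrite mulN1r.
Qed.

Lemma csumB I (f g : I -> K) : abs_summable f -> abs_summable g ->
  csum (fun i => f i - g i) = csum f - csum g.
Proof.
by move=> hf hg; rewrite csumD ?csumN//; apply: abs_summableN.
Qed.

Lemma csum_reindex I J (h : I -> J) (f : J -> K) : bijective h ->
  abs_summable f -> csum (fun i => f (h i)) = csum f.
Proof.
by move=> bh /csumP hf; apply: has_sum_csum; apply/(has_sum_reindex _ _ bh).
Qed.

Lemma csum_inj I J (h : I -> J) (f : J -> K) : injective h ->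
  (forall j, (forall i, h i != j) -> f j = 0) ->
  abs_summable f -> csum (fun i => f (h i)) = csum f.
Proof.
by move=> ih f0 /csumP hf; apply: has_sum_csum; apply/(has_sum_inj _ ih).
Qed.

Lemma csum_finite I (f : I -> K) (A : {fset I}) :
  (forall i, i \notin A -> f i = 0) -> csum f = \sum_(i <- A) f i.
Proof. by move=> /has_sum_finite/has_sum_csum. Qed.

Lemma csum_single I (f : I -> K) i : (forall j, j != i -> f j = 0) ->
  csum f = f i.
Proof.
move=> f0; rewrite (@csum_finite _ _ [fset i]%fset) ?big_seq_fset1// => j.
by rewrite inE => /f0.
Qed.

Lemma csum_norm_le I (f : I -> K) (M : K) : abs_summable f ->
  (forall A : {fset I}, `|\sum_(i <- A) f i| <= M) -> `|csum f| <= M.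
Proof. by move=> /csumP; apply: has_sum_norm_le. Qed.

Lemma csum_norm_leM I (f g : I -> K) (c B : K) :
  (forall A : {fset I}, \sum_(i <- A) `|g i| <= B) -> 0 <= c ->
  (forall i, `|f i| <= c * `|g i|) -> `|csum f| <= c * B.
Proof.
move=> hg c0 hf; have le (A : {fset I}) : \sum_(i <- A) `|f i| <= c * B.
  apply: le_trans (ler_wpM2l c0 (hg A)); rewrite mulr_sumr.
  exact: ler_sum.
apply: csum_norm_le => [|A]; first by exists (c * B).
exact: le_trans (ler_norm_sum _ _ _) (le A).
Qed.

Lemma csumD1 I (f : I -> K) i : abs_summable f ->
  csum f = f i + csum (fun j => if j == i then 0 else f j).
Proof.
move=> hf; have h0 j : j != i -> (if j == i then f i else 0) = 0.
  by move=> /negbTE ->.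
have := csum_single h0; rewrite eqxx => <-; rewrite -csumD.
- by apply: eq_csum => j; case: eqP => [->|_]; rewrite ?addr0 ?add0r.
- by apply: abs_summable_le hf => j; case: eqP => [->|_]; rewrite ?normr0.
- by apply: abs_summable_le hf => j; case: eqP => [->|_]; rewrite ?normr0.
Qed.

Lemma abs_summable_row I J (F : I -> J -> K) i :
  abs_summable (fun x => F x.1 x.2) -> abs_summable (F i).
Proof. by apply: (abs_summable_inj (h := fun j => (i, j))) => x y []. Qed.

Lemma csum_fubini I J (F : I -> J -> K) : abs_summable (fun x => F x.1 x.2) ->
  csum (fun x => F x.1 x.2) = csum (fun i => csum (F i)).
Proof.
move=> hF; apply/esym/has_sum_csum; apply: has_sum_fubini (csumP hF) _ => i.
by apply: csumP; apply: abs_summable_row hF.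
Qed.

Lemma abs_summable_swap I J (F : I -> J -> K) :
  abs_summable (fun x => F x.1 x.2) -> abs_summable (fun x => F x.2 x.1).
Proof.
by apply: (abs_summable_inj (h := fun x : J * I => (x.2, x.1))) => -[? ?] [? ?] [-> ->].
Qed.

Lemma csum_exchange I J (F : I -> J -> K) : abs_summable (fun x => F x.1 x.2) ->
  csum (fun i => csum (F i)) = csum (fun j => csum (fun i => F i j)).
Proof.
move=> hF; rewrite -csum_fubini//.
rewrite -(@csum_fubini _ _ (fun j i => F i j)); last exact: abs_summable_swap.
rewrite -[LHS](@csum_reindex _ _ (fun x : J * I => (x.2, x.1)))//.
by exists (fun x => (x.2, x.1)) => -[].
Qed.

(* The phases [u] turn the sum of the norms of the row sums into a sum of rows. *)
Lemma abs_summable_csum I J (F : I -> J -> K) :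
  abs_summable (fun x => F x.1 x.2) -> abs_summable (fun i => csum (F i)).
Proof.
move=> hF; have [M hM] := hF; exists M => B.
pose u i := if csum (F i) == 0 then 1 else `|csum (F i)| / csum (F i).
have nu i : `|u i| = 1.
  rewrite /u; case: eqVneq => [_|c0]; rewrite ?normr1// normf_div normr_id.
  by rewrite divff// normr_eq0.
have uE i : `|csum (F i)| = u i * csum (F i).
  by rewrite /u; case: eqVneq => [->|c0]; rewrite ?normr0 ?mulr0// divfK.
have hs : has_sum (fun j => \sum_(i <- B) u i * F i j)
                  (\sum_(i <- B) u i * csum (F i)).
  apply: has_sum_sum => i; apply: has_sumZ; apply: csumP.
  exact: abs_summable_row hF.
under eq_bigr do rewrite uE.
rewrite -[leLHS]ger0_norm; last by apply: sumr_ge0 => i _; rewrite -uE.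
apply: (has_sum_norm_le hs) => C.
pose s := [seq (i, j) | i <- B, j <- C].
have us : uniq s by apply: allpairs_uniq => // -[a b] [c d].
apply: le_trans (hM [fset x in s]%fset).
have -> : \sum_(x <- [fset x in s]%fset) `|F x.1 x.2|
        = \sum_(j <- C) \sum_(i <- B) `|F i j|.
  rewrite exchange_big/= (perm_big s); last first.
    by apply: uniq_perm; rewrite ?fset_uniq// => x; rewrite inE.
  by rewrite /s big_allpairs.
apply: le_trans (ler_norm_sum _ _ _) _; apply: ler_sum => j _.
apply: le_trans (ler_norm_sum _ _ _) _; apply: ler_sum => i _.
by rewrite normrM nu mul1r.
Qed.

Lemma abs_summable_cvg0 (f : nat -> K) e : abs_summable f -> 0 < e ->
  exists N, forall n, (N <= n)%N -> `|f n| < e.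
Proof.
move=> /csumP/has_sumP h e0.
have e20 : 0 < e / 2 by rewrite divr_gt0.
have [A hA] := h _ e20.
(* An index past the maximum of [A] lies outside [A]. Adjoining it keeps the partial sum within
   [e / 2] of the limit, so its term is smaller than [e]. *)
exists (\max_(i <- A) i).+1 => n Nn.
have nA : n \notin A.
  apply/negP => nA; move: Nn; rewrite ltnNge => /negP; apply.
  by rewrite (@leq_bigmax_seq _ (enum_fset A) xpredT id n).
have := hA A (fsubset_refl A); have := hA (n |` A)%fset (fsubsetUr _ _).
rewrite big_fsetU1//= => h1 h2.
rewrite -[f n](addrK (\sum_(i <- A) f i)) -[in ltLHS](subrKA (csum f)).
by rewrite (le_lt_trans (ler_normD _ _))// [e]splitr ltrD// distrC.
Qed.

End Complete.

(** * Powers of q and majorants for multiple series *)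

Section Powers.
Variable K : numFieldType.
Implicit Types (x q : K).

Lemma geometric_sum_le x n : 0 <= x -> x < 1 ->
  \sum_(0 <= k < n) x ^+ k <= (1 - x)^-1.
Proof.
move=> x0 x1; have x10 : 0 < 1 - x by rewrite subr_gt0.
rewrite -[leRHS]mul1r ler_pdivlMr//.
have -> : (\sum_(0 <= k < n) x ^+ k) * (1 - x) = 1 - x ^+ n.
  by rewrite -[in RHS](expr1n _ n) subrXX big_mkord mulrC; congr (_ * _);
    apply: eq_bigr => i _; rewrite expr1n mul1r.
by rewrite gerBl exprn_ge0.
Qed.

Lemma abs_summable_geometric q : `|q| < 1 -> abs_summable (fun n : nat => q ^+ n).
Proof.
move=> q1; exists (1 - `|q|)^-1 => A.
apply: le_trans (geometric_sum_le (\max_(i <- A) i).+1 (normr_ge0 q) q1).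
have -> : \sum_(i <- A) `|q ^+ i| = \sum_(i <- A) `|q| ^+ i.
  by apply: eq_bigr => i _; rewrite normrX.
have : forall i, i \in A -> i \in index_iota 0 (\max_(i <- A) i).+1.
  move=> i iA; rewrite mem_index_iota ltnS.
  by rewrite (@leq_bigmax_seq _ (enum_fset A) xpredT id i).
have : uniq (index_iota 0 (\max_(i <- A) i).+1) by exact: iota_uniq.
move: (index_iota _ _) => r ur Ar; rewrite [leRHS](perm_big [fset i in r]%fset).
  apply: le_sum_fset => [i|]; first exact: exprn_ge0.
  by apply/fsubsetP => i /Ar; rewrite inE.
by apply: uniq_perm; rewrite ?fset_uniq// => i; rewrite inE.
Qed.

Lemma abs_summable_int (f : int -> K) : abs_summable (fun n : nat => f n%:Z) ->
  abs_summable (fun n : nat => f (- n%:Z)) -> abs_summable f.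
Proof.
move=> h1 h2.
pose f1 (n : int) := if 0 <= n then f n else 0.
pose f2 (n : int) := if 0 <= n then 0 else f n.
apply: (@abs_summable_le _ _ _ (fun n => f1 n + f2 n)) => [n|].
  by rewrite /f1 /f2; case: ifP => _; rewrite ?addr0 ?add0r.
apply: abs_summableD.
  apply: (@abs_summable_ext _ _ _ Posz) => [m n []//|[n|n] hn|//].
    by have := hn n; rewrite eqxx.
  by rewrite /f1.
apply: (@abs_summable_ext _ _ _ (fun n : nat => - n%:Z)) => [m n /oppr_inj[]//|n hn|].
  rewrite /f2; case: ifP => // n0; have := hn `|n|%N.
  by rewrite abszE ler0_norm ?opprK ?eqxx//; move: n0; lia.
apply: abs_summable_le h2 => n; rewrite /f2; case: ifP => // _.
by rewrite normr0.
Qed.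

Lemma normr_exprz x (n : int) : `|x ^ n| = `|x| ^ n.
Proof. by case: n => n; rewrite ?NegzE ?exprnN ?normfV ?normrX. Qed.

Lemma normr_exprz_ge0 x (n : int) : 0 <= `|x| ^ n.
Proof. by rewrite -normr_exprz. Qed.

Lemma ler_exprz_norm q (m n : int) : q != 0 -> `|q| < 1 -> m <= n ->
  `|q| ^ n <= `|q| ^ m.
Proof.
move=> q0 q1 mn; have nq0 : `|q| != 0 by rewrite normr_eq0.
rewrite -(subrK m n) expfzDr// ler_piMl//.
  by rewrite -normr_exprz.
have -> : n - m = `|n - m|%N by move: mn; lia.
by rewrite -exprnP exprn_ile1// ltW.
Qed.

Lemma abs_summable_absz q : `|q| < 1 -> abs_summable (fun n : int => q ^ `|n|).
Proof.
move=> q1; have h := abs_summable_geometric q1.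
by apply: abs_summable_int; apply: abs_summable_le h => n; rewrite ?normrN.
Qed.

(** Convergence test by comparison with a product of four two-sided geometric series. The constant
    [C] absorbs the region where a quadratic exponent is below the linear bound; missing coordinates
    are filled with 0. *)
Lemma abs_summable_qexp (I : choiceType) (f : I -> K) q (M : K) (e : I -> int)
  (C : int) (a b c d : I -> int) : q != 0 -> `|q| < 1 ->
  injective (fun i => (a i, b i, c i, d i)) ->
  (forall i, `|a i| + `|b i| + `|c i| + `|d i| - C <= e i) ->
  (forall i, `|f i| <= M * `|q| ^ e i) -> abs_summable f.
Proof.
move=> q0 q1 hi he hf; have nq0 : `|q| != 0 by rewrite normr_eq0.
have h := abs_summable_absz q1.
have := abs_summable_inj hi
  (abs_summable_pair (abs_summable_pair (abs_summable_pair h h) h) h).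
move=> /= /(abs_summableZ (`|M| * q ^ (- C))).
apply: abs_summable_le => i; apply: le_trans (hf i) _.
rewrite -!expfzDr// !normrM normr_id -mulrA -normrM -expfzDr// normr_exprz.
rewrite [- C + _]addrC; apply: ler_pM.
- by have := le_trans (normr_ge0 _) (hf i); rewrite pmulr_lge0// -normr_exprz normr_gt0 expfz_neq0.
- by rewrite -normr_exprz.
- have M0 : 0 <= M.
    by have := le_trans (normr_ge0 _) (hf i); rewrite pmulr_lge0// -normr_exprz normr_gt0 expfz_neq0.
  by rewrite ger0_norm.
- exact: ler_exprz_norm.
Qed.

End Powers.

(** * q-Pochhammer symbols *)

(* Extended by 0 to negative integers, so that all sums run over [int] and
   reindexing maps are affine bijections. *)
Definition rho (K : numFieldType) (p : K) (n : int) : K :=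
  if n is Posz m then (qpoch p p m)^-1 else 0.

Section Pochhammer.
Variable K : numFieldType.
Hypothesis Kc : abs_complete K.
Implicit Types a p z w : K.

(** In a non-archimedean field [|p| < 1] would not make the powers small. Completeness does: the
    geometric series is absolutely summable, so its terms tend to 0. *)
Lemma expr_lt_eps p e : `|p| < 1 -> 0 < e ->
  exists N, forall n, (N <= n)%N -> `|p ^+ n| < e.
Proof. by move=> /abs_summable_geometric h; apply: abs_summable_cvg0 Kc _ _ h. Qed.

Lemma qpochS a p n : qpoch a p n.+1 = qpoch a p n * (1 - a * p ^+ n).
Proof. by rewrite /qpoch big_nat_recr. Qed.

Lemma qpochD a p m n : qpoch a p (m + n) = qpoch a p m * qpoch (a * p ^+ m) p n.
Proof.
elim: n => [|n IHn]; first by rewrite addn0 /qpoch [X in _ * X]big_nil mulr1.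
by rewrite addnS !qpochS IHn -!mulrA -exprD addnC.
Qed.

Lemma qpoch_neq0 a p n : (forall k, a * p ^+ k != 1) -> qpoch a p n != 0.
Proof.
move=> h; elim: n => [|n IHn]; first by rewrite /qpoch big_nil oner_eq0.
by rewrite qpochS mulf_neq0// subr_eq0 eq_sym.
Qed.

(** Weierstrass inequality: a product of factors [1 - x_k] is at least 1 minus the sum of the [x_k],
    here a geometric sum of at most 1/2. *)
Lemma qpoch_ge a p n : `|p| < 1 -> `|a| * (1 - `|p|)^-1 <= 1 / 2 ->
  1 / 2 <= `|qpoch a p n|.
Proof.
move=> p1 ha; have p10 : 0 < 1 - `|p| by rewrite subr_gt0.
suff h : 1 - \sum_(0 <= k < n) `|a| * `|p| ^+ k <= `|qpoch a p n|.
  apply: le_trans h; rewrite lerBrDr -lerBrDl -mulr_sumr.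
  apply: (le_trans (ler_wpM2l (normr_ge0 a) (geometric_sum_le n _ p1))) => //.
  by apply: le_trans ha _; have -> : 1 - 1 / 2 = 1 / 2 :> K by field.
elim: n => [|n IHn]; first by rewrite big_nil subr0 /qpoch big_nil normr1.
rewrite qpochS big_nat_recr//= normrM.
set S := \sum_(0 <= k < n) _ in IHn *; set x := `|a| * _.
have S0 : 0 <= S by apply: sumr_ge0 => i _; rewrite mulr_ge0// exprn_ge0.
have x0 : 0 <= x by rewrite mulr_ge0// exprn_ge0.
have S1 : S <= 1 / 2.
  by rewrite /S -mulr_sumr (le_trans _ ha)// ler_wpM2l// geometric_sum_le.
have x1 : x <= 1.
  apply: le_trans (_ : `|a| * 1 <= _); first by rewrite ler_wpM2l// exprn_ile1// ltW.
  rewrite mulr1; apply: le_trans (_ : 1 / 2 <= 1); last first.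
    by rewrite mul1r invf_le1 ?ltr0n// ler1n.
  apply: le_trans ha; rewrite ler_peMr// invf_ge1// gerBl//.
have S2 : 0 <= 1 - S.
  by rewrite subr_ge0 (le_trans S1)// mul1r invf_le1 ?ltr0n// ler1n.
apply: le_trans (_ : (1 - S) * (1 - x) <= _).
  have -> : (1 - S) * (1 - x) = 1 - (S + x) + S * x by ring.
  by rewrite lerDl mulr_ge0.
apply: ler_pM => //; first by rewrite subr_ge0.
have -> : x = `|a * p ^+ n| by rewrite normrM normrX.
by rewrite -[X in X - _](normr1 K) lerB_dist.
Qed.

(** The product is cut at an [N] past which [qpoch_ge] applies: the tail has inverse at most 2, and
    the finitely many inverses before it are bounded by their sum [S]. *)
Lemma qpoch_inv_bounded a p : `|p| < 1 -> (forall k, a * p ^+ k != 1) ->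
  exists M, forall n, `|(qpoch a p n)^-1| <= M.
Proof.
move=> p1 h; have p10 : 0 < 1 - `|p| by rewrite subr_gt0.
have e0 : 0 < (1 - `|p|) / 2 by rewrite divr_gt0.
have [N hN] := abs_summable_cvg0 Kc
  (abs_summableZ a (abs_summable_geometric p1)) e0.
pose S := \sum_(0 <= k < N.+1) `|(qpoch a p k)^-1|.
have S0 : 0 <= S by apply: sumr_ge0.
have hS k : (k <= N)%N -> `|(qpoch a p k)^-1| <= S.
  move=> kN; rewrite /S big_mkord (bigD1 (Ordinal (kN : (k < N.+1)%N)))//=.
  by rewrite lerDl sumr_ge0.
exists (S * 2) => n; have [nN|Nn] := leqP n N.
  by apply: le_trans (hS _ nN) _; rewrite ler_peMr// ler1n.
rewrite -(subnKC (ltnW Nn)) qpochD invfM normrM; apply: ler_pM => //; first exact: hS.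
rewrite normfV -[leRHS]invrK lef_pV2 ?posrE ?normr_gt0 ?invr_gt0//; last first.
  by apply: qpoch_neq0 => k; rewrite -mulrA -exprD.
rewrite -[leLHS]mul1r; apply: qpoch_ge => //.
by rewrite ler_pdivrMr// mul1r [leRHS]mulrC ltW// hN.
Qed.

Lemma expr_neq1 p k : `|p| < 1 -> p * p ^+ k != 1.
Proof.
move=> p1; apply: contraTneq p1 => h.
have : `|p| ^+ k.+1 = 1 by rewrite -normrX exprS h normr1.
by move=> h2; rewrite -(@expr_lt1 _ k.+1)// h2 ltxx.
Qed.

Lemma rho0 p : rho p 0 = 1.
Proof. by rewrite -[0]/(Posz 0) /= /qpoch big_nil invr1. Qed.

Lemma rho_lt0 p n : n < 0 -> rho p n = 0.
Proof. by case: n. Qed.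

Lemma rho_bounded p : `|p| < 1 -> exists M, 0 <= M /\ forall n, `|rho p n| <= M.
Proof.
move=> p1; have [M hM] := qpoch_inv_bounded p1 (fun k => expr_neq1 k p1).
have M0 : 0 <= M by apply: le_trans (hM 0%N).
by exists M; split=> // -[n|n] //=; rewrite normr0.
Qed.

Lemma subr_expz_neq0 p (n : int) : `|p| < 1 -> 0 < n -> 1 - p ^ n != 0.
Proof.
case: n => // -[//|n] p1 _; rewrite subr_eq0 eq_sym -exprnP exprS.
exact: expr_neq1.
Qed.

(** No sign condition is needed: at [n = 0] the factor [1 - p ^ 0] matches the value 0 of [rho] at
    -1. All recurrences below come from this rule. *)
Lemma rhoS p (n : int) : `|p| < 1 -> (1 - p ^ n) * rho p n = rho p (n - 1).
Proof.
move=> p1; case: n => [[|n]|n]; last by rewrite rho_lt0 ?mulr0 ?rho_lt0//; lia.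
  by rewrite expr0z subrr mul0r.
rewrite (_ : Posz n.+1 - 1 = n); last by lia.
have h : 1 - p * p ^+ n != 0 by rewrite subr_eq0 eq_sym expr_neq1.
by rewrite /= qpochS -exprnP exprS invfM mulrCA divff ?mulr1.
Qed.

End Pochhammer.

(** * Theorems of Euler, Durfee and Jacobi *)

Section Jacobi.
Variable K : numFieldType.
Hypothesis Kc : abs_complete K.
Variable w : K.
Hypotheses (w0 : w != 0) (w1 : `|w| < 1).
Implicit Types a z : K.
Notation p := (w ^+ 2).

Let p0 : p != 0. Proof. by rewrite expf_neq0. Qed.
Let p1 : `|p| < 1. Proof. by rewrite normrX expr_lt1. Qed.

Lemma sqr_exprz (n : int) : p ^ n = w ^ (2 * n).
Proof. by rewrite exprnP exprz_exp. Qed.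

(** Summand of Euler's series for (-z; p)_oo. The base is a square so that p^(n(n-1)/2) is written
    without halving. *)
Definition euler_term z (n : int) : K := w ^ (n * n - n) * z ^ n * rho p n.

Lemma euler_summable z : z != 0 -> abs_summable (euler_term z).
Proof.
move=> z0; have [M [M0 hM]] := rho_bounded Kc p1.
have e0 : 0 < (1 + `|z|)^-1 by rewrite invr_gt0 ltr_wpDr.
(* With this [k] one has [|z * p ^+ k| <= 1], so the growth of [z ^ n] costs only the linear
   exponent [- 2 k n], which [n * n] dominates. *)
have [k hk] := expr_lt_eps Kc p1 e0.
apply: (@abs_summable_qexp _ _ _ w M (fun n => n * n - n - 2 * k%:Z * n)
  ((2 * k%:Z + 3) ^+ 2) id (fun=> 0) (fun=> 0) (fun=> 0)) => // [i j [->]//|i|[n|n]].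
- by nia.
- rewrite /euler_term normrM mulrC; apply: ler_pM => //.
  rewrite normrM !normr_exprz.
  rewrite [leRHS]expfzDr ?normr_eq0// ler_wpM2l ?normr_exprz_ge0//.
  have -> : `|w| ^ (- (2 * k%:Z * n%:Z)) = (`|p ^+ k| ^+ n)^-1.
    by rewrite !normrX !exprnP !exprz_exp invr_expz; congr (_ ^ _); lia.
  have wk : 0 < `|p ^+ k| by rewrite normr_gt0 expf_neq0.
  rewrite -exprnP -[leRHS]mul1r ler_pdivlMr ?exprn_gt0// -exprMn.
  apply: exprn_ile1; first by rewrite mulr_ge0.
  apply: le_trans (ler_wpM2l (normr_ge0 z) (ltW (hk k (leqnn k)))) _.
  by rewrite ler_pdivrMr ?ltr_wpDr// mul1r lerDr.
- by rewrite /euler_term rho_lt0// mulr0 normr0 mulr_ge0// normr_exprz_ge0.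
Qed.

Definition euler z := csum (euler_term z).

(** Subtracting the series at [z * p] from the one at [z] creates the factor [1 - p ^ n], which
    lowers the index of [rho]; shifting n back leaves [z * euler (z * p)]. *)
Lemma euler_rec z : z != 0 -> euler z = (1 + z) * euler (z * p).
Proof.
move=> z0; have zp0 : z * p != 0 by rewrite mulf_neq0.
have s1 := euler_summable z0; have s2 := euler_summable zp0.
rewrite mulrDl mul1r; apply/eqP; rewrite addrC -subr_eq; apply/eqP.
rewrite /euler -(csumB Kc s1 s2) -(csumZ Kc z s2).
rewrite -[RHS](@csum_reindex _ Kc _ _ (fun n : int => n - 1)); last 2 first.
- by exists (fun n => n + 1) => n; rewrite ?addrK ?subrK.
- exact: abs_summableZ.
apply: eq_csum => n; rewrite /euler_term -(rhoS _ p1) ![(z * p) ^ _]expfzMl !sqr_exprz.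
have zn : z ^ n = z * z ^ (n - 1) by rewrite -[X in X * _]expr1z -expfzDr//; congr (_ ^ _); ring.
have -> : w ^ ((n - 1) * (n - 1) - (n - 1)) * (z ^ (n - 1) * w ^ (2 * (n - 1))) = w ^ (n * n - n) * z ^ (n - 1).
  rewrite mulrCA mulrC -expfzDr//; congr (_ ^ _ * _); ring.
rewrite zn; ring.
Qed.

Lemma qpoch_euler z n : z != 0 -> qpoch (- z) p n * euler (z * p ^+ n) = euler z.
Proof.
move=> z0; elim: n => [|n IHn]; first by rewrite /qpoch big_nil mul1r expr0 mulr1.
rewrite -IHn qpochS [in RHS]euler_rec ?mulf_neq0 ?expf_neq0//.
by rewrite mulNr opprK [p ^+ n.+1]exprSr !mulrA.
Qed.

(** For [|z| <= 1] every term after the constant one carries a factor z, so the series at [z = 1]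
    gives the bound. *)
Lemma euler_near1 : exists B, 0 <= B /\
  forall z, z != 0 -> `|z| <= 1 -> `|euler z - 1| <= `|z| * B.
Proof.
have [B hB] := euler_summable (oner_neq0 K).
have B0 : 0 <= B by have := hB fset0; rewrite big_seq_fset0.
exists B; split=> // z z0 z1; rewrite /euler (csumD1 Kc 0 (euler_summable z0)).
rewrite {1}/euler_term !expr0z rho0 !mulr1 addrAC subrr add0r.
apply: (csum_norm_leM Kc hB) => // -[[|n]|n]; rewrite /euler_term /=.
- by rewrite normr0 mulr_ge0.
- rewrite !normrM exp1rz normr1 mulr1 mulrAC [leRHS]mulrC ler_wpM2l ?mulr_ge0//.
  by rewrite normrX exprS ler_piMr// exprn_ile1.
- by rewrite !mulr0 normr0 mulr0.
Qed.

(** The product of [qpoch (- z) p n] and [euler (z * p ^+ n)] is independent of n, and the second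
    factor tends to 1. Convergence of the infinite product is thus a consequence, not an input. *)
Lemma qpoch_cvg_euler z : z != 0 -> qpoch (- z) p @ \oo --> euler z.
Proof.
move=> z0; have [B [B0 hB]] := euler_near1.
apply/cvgrPdist_lt => e e0.
have E0 c : 0 <= c -> 0 < 1 + c by move=> c0; rewrite ltr_wpDr.
have zB : 0 <= `|z| * B by rewrite mulr_ge0.
(* [N1] brings [z * p ^+ n] into the unit disc, [N2] puts [y] within 1/2 of 1, which bounds the
   finite product by twice [|euler z|], and [N3] gives the final [e]. The added 1's keep the
   denominators positive. *)
have [|N1 h1] := expr_lt_eps Kc p1 (_ : 0 < (1 + `|z|)^-1).
  by rewrite invr_gt0 E0.
have [|N2 h2] := expr_lt_eps Kc p1 (_ : 0 < (1 + `|z| * B)^-1 / 2).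
  by rewrite divr_gt0// invr_gt0 E0.
have Ez : 0 <= 2 * `|euler z| * (`|z| * B) by rewrite !mulr_ge0.
have [|N3 h3] := expr_lt_eps Kc p1 (_ : 0 < e / (1 + 2 * `|euler z| * (`|z| * B))).
  by rewrite divr_gt0// E0.
exists (N1 + N2 + N3)%N => // n /= Nn.
have {}h1 := h1 n ltac:(lia); have {}h2 := h2 n ltac:(lia).
have {}h3 := h3 n ltac:(lia).
have zn0 : z * p ^+ n != 0 by rewrite mulf_neq0 ?expf_neq0.
have zn1 : `|z * p ^+ n| <= 1.
  rewrite normrM; apply: le_trans (ler_wpM2l (normr_ge0 z) (ltW h1)) _.
  by rewrite ler_pdivrMr ?E0// mul1r lerDr.
have := hB _ zn0 zn1; set y := euler (z * p ^+ n) => hy.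
have {}hy : `|y - 1| <= `|p ^+ n| * (`|z| * B).
  by apply: le_trans hy _; rewrite normrM mulrCA mulrA.
have y12 : `|y - 1| <= 1 / 2.
  apply: le_trans hy _; apply: le_trans (ler_wpM2r zB (ltW h2)) _.
  rewrite mulrAC ler_wpM2r// mulrC ler_pdivrMr ?E0// mul1r lerDr//.
have y1 : 1 / 2 <= `|y|.
  rewrite -[y](subrK 1) addrC; apply: le_trans (lerB_normD _ _).
  rewrite normr1; have -> : 1 / 2 = 1 - 1 / 2 :> K by field.
  by rewrite lerB.
rewrite -(qpoch_euler n z0) -/y; set P := qpoch _ _ _.
have hP : `|P| <= 2 * `|euler z|.
  rewrite -(qpoch_euler n z0) -/y -/P normrM mulrCA ler_peMr//.
  by rewrite -ler_pdivrMl// mulrC.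
rewrite -[X in _ - X]mulr1 -mulrBr normrM.
apply: le_lt_trans (ler_pM _ _ hP hy) _ => //.
rewrite mulrCA; apply: le_lt_trans (_ : _ <= `|p ^+ n| * (1 + 2 * `|euler z| * (`|z| * B))) _.
  by rewrite ler_wpM2l// lerDr.
by rewrite -ltr_pdivlMr ?E0.
Qed.

End Jacobi.

(** * The Durfee rectangle identity and the Jacobi triple product *)

Section Durfee.
Variable K : numFieldType.
Hypothesis Kc : abs_complete K.
Variable w : K.
Hypotheses (w0 : w != 0) (w1 : `|w| < 1).
Implicit Types a z : K.
Notation p := (w ^+ 2).

Let p0 : p != 0. Proof. by rewrite expf_neq0. Qed.
Let p1 : `|p| < 1. Proof. by rewrite normrX expr_lt1. Qed.

Lemma qpoch_infE z : z != 0 -> qpoch_inf (- z) p = euler w z.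
Proof.
by move=> z0; apply: cvg_lim; [exact: norm_hausdorff|exact: qpoch_cvg_euler].
Qed.

Lemma qpoch_cvg a : a != 0 -> qpoch a p @ \oo --> qpoch_inf a p.
Proof.
move=> a0; rewrite -[a]opprK qpoch_infE ?oppr_eq0//.
by apply: qpoch_cvg_euler => //; rewrite oppr_eq0.
Qed.

(** The inverses of the partial products are bounded, so the partial products stay away from 0. *)
Lemma qpoch_inf_neq0 a : a != 0 -> (forall k, a * p ^+ k != 1) ->
  qpoch_inf a p != 0.
Proof.
move=> a0 ha; have [M hM] := qpoch_inv_bounded Kc p1 ha.
have M0 : 0 < 1 + M by rewrite ltr_wpDr// (le_trans _ (hM 0%N)).
apply/eqP => h; have := qpoch_cvg a0; rewrite h => /cvgrPdist_lt.
move=> /(_ (1 + M)^-1); rewrite invr_gt0 => /(_ M0)[N _ /(_ N (leqnn N))] /=.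
rewrite sub0r normrN => lt; have := hM N; rewrite normfV => le.
have P0 : 0 < `|qpoch a p N| by rewrite normr_gt0 qpoch_neq0.
have : 1 + M < `|qpoch a p N|^-1 by rewrite -[ltLHS]invrK ltf_pV2// posrE ?invr_gt0.
move=> /lt_le_trans/(_ le); rewrite gtrDr => /lt_trans/(_ (ltr01)).
by rewrite ltxx.
Qed.

Definition durfee_term (D v : int) : K :=
  w ^ (2 * (v * (v + D))) * (rho p v * rho p (v + D)).

Lemma durfee_summable D : abs_summable (durfee_term D).
Proof.
have [M [M0 hM]] := rho_bounded Kc p1.
apply: (@abs_summable_qexp _ _ _ w (M * M) (fun v => 2 * (v * (v + D)))
  ((`|D| + 1) ^+ 2) id (fun=> 0) (fun=> 0) (fun=> 0)) => // [i j [->]//|i|i].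
  by nia.
rewrite /durfee_term mulrC normrM normr_exprz ler_wpM2r ?normr_exprz_ge0//.
by rewrite normrM ler_pM.
Qed.

Let A D := csum (durfee_term D).

(** With the index of [A (D + 1 + 1)] lowered by 1, both sides have the coefficient p^(v(v+D)) (1 -
    p^v - p^(v+D+1)) at [rho p v * rho p (v + (D + 1))]. *)
Lemma durfee_rec D : A D - A (D + 1) = p ^ (D + 1) * (A (D + 1 + 1) - A (D + 1)).
Proof.
have s := durfee_summable; rewrite mulrBr -!(csumZ Kc)//.
have bij : bijective (fun v : int => v - 1).
  by exists (fun v => v + 1) => v; rewrite ?addrK ?subrK.
have s' := abs_summableZ (p ^ (D + 1)) (s (D + 1 + 1)).
rewrite -(csum_reindex Kc bij s') -!(csumB Kc)//; last 2 first.
- exact: abs_summable_inj (bij_inj bij) s'.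
- exact: abs_summableZ.
apply: eq_csum => v; rewrite /durfee_term.
rewrite (_ : v - 1 + (D + 1 + 1) = v + (D + 1)); last by ring.
rewrite -(rhoS v p1) (_ : v + D = v + (D + 1) - 1); last by ring.
rewrite -(rhoS (v + (D + 1)) p1) !sqr_exprz.
have -> : w ^ (2 * (v * (v + (D + 1)))) = w ^ (2 * (v * (v + (D + 1) - 1))) * w ^ (2 * v).
  by rewrite -expfzDr//; congr (_ ^ _); ring.
have -> : w ^ (2 * ((v - 1) * (v + (D + 1)))) =
    w ^ (2 * (v * (v + (D + 1) - 1))) * w ^ (- (2 * (D + 1))).
  by rewrite -expfzDr//; congr (_ ^ _); ring.
have -> : w ^ (2 * (v + (D + 1))) = w ^ (2 * v) * w ^ (2 * (D + 1)).
  by rewrite -expfzDr//; congr (_ ^ _); ring.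
have h : w ^ (- (2 * (D + 1))) * w ^ (2 * (D + 1)) = 1.
  by rewrite -expfzDr// addNr expr0z.
set x := w ^ (2 * (D + 1)) in h *; set y := w ^ (- _) in h *.
rewrite [X in _ = X - _](_ : _ = (y * x) * (w ^ (2 * (v * (v + (D + 1) - 1))) * ((1 - w ^ (2 * v)) * rho p v * rho p (v + (D + 1))))); last by ring.
by rewrite h; ring.
Qed.

(** For nonnegative n each term with [v >= 1] carries a power of w of exponent at least n, so [A n]
    is close to its term at [v = 0], which is [rho p n]. *)
Let durfee_bound : exists B, 0 <= B /\ forall n : nat,
  `|A n%:Z| <= B /\ `|A n%:Z - rho p n%:Z| <= `|w ^+ n| * B.
Proof.
have [M [M0 hM]] := rho_bounded Kc p1.
have [B hB] : abs_summable (fun v : int => M * M * w ^ (2 * (v * v))).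
  apply: (@abs_summable_qexp _ _ _ w (M * M) (fun v => 2 * (v * v))
    0 id (fun=> 0) (fun=> 0) (fun=> 0)) => // [i j [->]//|i|i].
    by nia.
  by rewrite normrM normr_exprz ger0_norm// mulr_ge0.
have B0 : 0 <= B by have := hB fset0; rewrite big_seq_fset0.
exists B; split=> // n.
have le (v : nat) k : (k <= 2 * v * n)%N ->
    `|durfee_term n v| <= `|w ^+ k| * `|M * M * w ^ (2 * (v%:Z * v%:Z))|.
  move=> hk; rewrite /durfee_term normrM.
  have -> : `|w ^+ k| * `|M * M * w ^ (2 * (v%:Z * v%:Z))| =
      (`|w ^+ k| * `|w ^ (2 * (v%:Z * v%:Z))|) * (M * M).
    by rewrite !normrM (ger0_norm M0); ring.
  apply: ler_pM => //; last by rewrite normrM ler_pM.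
  rewrite exprnP !normr_exprz -expfzDr ?normr_eq0//.
  by apply: ler_exprz_norm => //; nia.
have neg (v : nat) : durfee_term n (Negz v) = 0.
  by rewrite /durfee_term rho_lt0// mul0r mulr0.
split.
  rewrite -[B]mul1r; apply: (csum_norm_leM Kc hB) => // -[v|v].
    by have := le v 0%N isT; rewrite expr0 normr1.
  by rewrite neg normr0 mul1r.
rewrite /A (csumD1 Kc 0 (durfee_summable n)) {1}/durfee_term.
rewrite mul0r mulr0 expr0z add0r rho0 !mul1r addrAC subrr add0r.
apply: (csum_norm_leM Kc hB) => // -[[|v]|v].
- by rewrite eqxx normr0 mulr_ge0.
- by apply: le; nia.
- by rewrite neg ?if_same normr0 mulr_ge0.
Qed.

(** By [durfee_rec] the differences satisfy [d D = - p ^ (D + 1) * d (D + 1)]. Iterating upwards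
    makes a bounded quantity smaller than any power of p, so [d] vanishes and [A] is constant; its
    value is the limit of [rho p n]. *)
Lemma durfee D : csum (durfee_term D) = (qpoch_inf p p)^-1.
Proof.
rewrite -/(A D); have [B [B0 hB]] := durfee_bound.
pose d D := A D - A (D + 1).
have dB (n : nat) : `|d n%:Z| <= B + B.
  by apply: le_trans (ler_normB _ _) _; rewrite -PoszD lerD//; have [] := hB (n + 1)%N; have [] := hB n.
have dS D' : d D' = - (p ^ (D' + 1) * d (D' + 1)).
  by rewrite /d durfee_rec; ring.
have dk k (n : nat) : `|d n%:Z| <= `|p ^+ k| * (B + B).
  elim: k n => [|k IHk] n; first by rewrite expr0 normr1 mul1r.
  rewrite dS normrN normrM [in leRHS]exprS normrM -mulrA -PoszD; apply: ler_pM => //.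
  by rewrite -exprnP addn1 !normrX [leLHS]exprS ler_piMr ?exprn_ile1 ?exprn_ge0// ltW// expr_lt1.
have d0 (n : nat) : d n = 0.
  apply/eqP; rewrite -normr_eq0 -[_ == 0]negbK; apply/negP => dn.
  have dn0 : 0 < `|d n| by rewrite lt_def dn /=.
  have B1 : 0 < 1 + (B + B) by rewrite ltr_wpDr// addr_ge0.
  have [|k /(_ k (leqnn k))] := expr_lt_eps Kc p1 (_ : 0 < `|d n| / (1 + (B + B))).
    by rewrite divr_gt0.
  rewrite ltr_pdivlMr// => lt; suff : `|d n| < `|d n| by rewrite ltxx.
  apply: le_lt_trans (dk k n) _; apply: le_lt_trans lt.
  by rewrite ler_wpM2l// lerDr.
have dneg (n : nat) : d (- n%:Z) = 0.
  elim: n => [|n IHn]; first exact: d0.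
  by rewrite dS (_ : - n.+1%:Z + 1 = - n%:Z) ?IHn ?mulr0 ?oppr0//; lia.
have dz D' : d D' = 0.
  by case: D' => n; rewrite ?NegzE.
have AS D' : A (D' + 1) = A D' by apply/esym/eqP; rewrite -subr_eq0; apply/eqP/dz.
have An (n : nat) : A n%:Z = A 0.
  by elim: n => // n IHn; rewrite -addn1 PoszD AS.
have AN (n : nat) : A (- n%:Z) = A 0.
  elim: n => [|n IHn]; first by rewrite oppr0.
  by rewrite -IHn -(AS (- n.+1%:Z)); congr A; lia.
have -> : A D = A 0 by case: D => n; rewrite ?NegzE.
have lim1 : (fun n : nat => rho p n) @ \oo --> A 0.
  apply/cvgrPdist_lt => e e0; have B1 : 0 < 1 + B by rewrite ltr_wpDr.
  have [|N hN] := expr_lt_eps Kc w1 (_ : 0 < e / (1 + B)); first by rewrite divr_gt0.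
  exists N => // n /= /hN; rewrite ltr_pdivlMr//.
  apply: le_lt_trans; rewrite -(An n); apply: le_trans (hB n).2 _.
  by rewrite ler_wpM2l// lerDr.
have lim2 : (fun n : nat => rho p n) @ \oo --> (qpoch_inf p p)^-1.
  apply: cvgV; last exact: qpoch_cvg.
  by apply: qpoch_inf_neq0 => // k; apply: expr_neq1.
by apply: (cvg_unique _ lim1 lim2); exact: norm_hausdorff.
Qed.

(** The two Euler series are multiplied and grouped by the difference D of their indices. The part
    depending on D is the theta summand, and the rest is a Durfee sum, which has the same value for
    every D. *)
Lemma jacobi z : z != 0 ->
  csum (fun n : int => w ^ (n * n - n) * z ^ n) =
  qpoch_inf (- z) p * qpoch_inf (- (p / z)) p * qpoch_inf p p.
Proof.
move=> z0; have pz0 : p / z != 0 by rewrite mulf_neq0// invr_eq0.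
have P0 : qpoch_inf p p != 0.
  by apply: qpoch_inf_neq0 => // k; apply: expr_neq1.
have s1 := euler_summable Kc w0 w1 z0; have s2 := euler_summable Kc w0 w1 pz0.
rewrite !qpoch_infE// /euler -(csumZr Kc)//.
under [in RHS]eq_csum do rewrite -(csumZ Kc)//.
have s12 := abs_summable_pair s1 s2.
have bij : bijective (fun x : int * int => (x.2 + x.1, x.2)).
  by exists (fun x => (x.1 - x.2, x.2)) => -[a b] /=; congr (_, _); ring.
rewrite -(csum_fubini Kc (F := fun u v => euler_term w z u * euler_term w (p / z) v) s12).
rewrite -(csum_reindex Kc bij s12) /=.
have e D v : euler_term w z (v + D) * euler_term w (p / z) v =
    w ^ (D * D - D) * z ^ D * durfee_term D v.
  have zz : (p / z) ^ v = w ^ (2 * v) * z ^ (- v).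
    by rewrite [(p / z) ^ v]expfzMl sqr_exprz exprz_inv.
  rewrite /euler_term /durfee_term zz.
  have hw : w ^ ((v + D) * (v + D) - (v + D)) * w ^ (v * v - v) * w ^ (2 * v) =
      w ^ (D * D - D) * w ^ (2 * (v * (v + D))).
    by rewrite -!expfzDr//; congr (_ ^ _); ring.
  have zD : z ^ D = z ^ (v + D) * z ^ (- v) by rewrite -expfzDr//; congr (_ ^ _); ring.
  rewrite zD; rewrite [LHS](_ : _ = (w ^ ((v + D) * (v + D) - (v + D)) * w ^ (v * v - v) * w ^ (2 * v))
    * (z ^ (v + D) * z ^ (- v) * (rho p v * rho p (v + D)))); last by ring.
  by rewrite hw; ring.
have sj := abs_summable_inj (bij_inj bij) s12.
have sj' : abs_summable (fun x => w ^ (x.1 * x.1 - x.1) * z ^ x.1 * durfee_term x.1 x.2).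
  by apply: abs_summable_le sj => -[D v] /=; rewrite e.
rewrite (@eq_csum _ _ _ (fun x => w ^ (x.1 * x.1 - x.1) * z ^ x.1 * durfee_term x.1 x.2)); last first.
  by move=> x /=; rewrite e.
rewrite (csum_fubini Kc (F := fun D v => w ^ (D * D - D) * z ^ D * durfee_term D v) sj').
have -> : (fun D => csum (fun v => w ^ (D * D - D) * z ^ D * durfee_term D v)) =
    (fun D => w ^ (D * D - D) * z ^ D * (qpoch_inf p p)^-1).
  by apply/funext => D; rewrite csumZ ?durfee//; exact: durfee_summable.
rewrite csumZr ?mulfVK//.
(* The theta series inherits summability from the double series, whose row sums are its terms
   divided by [qpoch_inf p p]. *)
have := abs_summable_csum Kc (F := fun D v => w ^ (D * D - D) * z ^ D * durfee_term D v) sj'.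
move=> /(abs_summableZ (qpoch_inf p p)); apply: abs_summable_le => D.
by rewrite (csumZ Kc _ (durfee_summable D)) durfee mulrCA (mulfV P0) mulr1.
Qed.

End Durfee.

(** * Convolution with Gaussian kernels *)

Section Convolution.
Variable K : numFieldType.
Hypothesis Kc : abs_complete K.
Variable Q : K.
Hypotheses (Q0 : Q != 0) (Q1 : `|Q| < 1).
Notation p := ((Q ^+ 2) ^+ 2).
Notation r := (rho p).
Notation rinf := ((qpoch_inf p p)^-1).

Let w0 : Q ^+ 2 != 0. Proof. by rewrite expf_neq0. Qed.
Let w1 : `|Q ^+ 2| < 1. Proof. by rewrite normrX expr_lt1. Qed.
Let p0 : p != 0. Proof. by rewrite !expf_neq0. Qed.
Let p1 : `|p| < 1. Proof. by rewrite normrX expr_lt1. Qed.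

Lemma quart_exprz (n : int) : p ^ n = Q ^ (4 * n).
Proof. by rewrite !sqr_exprz mulrA. Qed.

Let rS (n : int) : (1 - Q ^ (4 * n)) * r n = r (n - 1).
Proof. by rewrite -quart_exprz rhoS. Qed.

Lemma abs_summable_gauss : abs_summable (fun x : int => Q ^ (x * x)).
Proof.
apply: (@abs_summable_qexp _ _ _ Q 1 (fun x => x * x)
  0 id (fun=> 0) (fun=> 0) (fun=> 0)) => // [i j [->]//|i|i].
  by nia.
by rewrite normr_exprz mul1r.
Qed.

Definition durfee_shift_term (j D v : int) : K :=
  Q ^ ((2 * v + D - j) * (2 * v + D - j)) * (r v * r (v + D)).

Lemma durfee_shift_term_summable j D : abs_summable (durfee_shift_term j D).
Proof.
have [M [M0 hM]] := rho_bounded Kc p1.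
rewrite /durfee_shift_term; under eq_fun do rewrite mulrC.
apply: (abs_summableM (M := M * M)) => [v|]; first by rewrite normrM ler_pM.
apply: (abs_summable_inj (h := fun v => 2 * v + D - j)) abs_summable_gauss.
by move=> u v; lia.
Qed.

Definition durfee_shift j D := csum (durfee_shift_term j D).

(** Lowering both j and D keeps [2 v + D - j] and brings in [1 - p^(v+D)] through [rhoS]; the factor
    in front of the second sum restores the term with p^(v+D). *)
Lemma durfee_shift_rec j D : durfee_shift j D = durfee_shift (j - 1) (D - 1) + Q ^ (2 * D + 2 * j - 1) * durfee_shift (j - 1) D.
Proof.
have s := durfee_shift_term_summable; rewrite /durfee_shift -(csumZ Kc)// -(csumD Kc)//; last exact: abs_summableZ.
apply: eq_csum => v; rewrite /durfee_shift_term.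
have -> : r (v + (D - 1)) = (1 - Q ^ (4 * (v + D))) * r (v + D).
  by rewrite rS; congr r; ring.
have -> : 2 * v + (D - 1) - (j - 1) = 2 * v + D - j by ring.
set E := Q ^ ((_ - j) * _).
have : Q ^ (2 * D + 2 * j - 1) * Q ^ ((2 * v + D - (j - 1)) * (2 * v + D - (j - 1)))
    = E * Q ^ (4 * (v + D)) by qpow.
rewrite [X in _ = _ + X]mulrA => ->; ring.
Qed.

(** For [0 <= e <= j], [r e * r (j - e)] is [r j] times a Gaussian binomial coefficient, so the sum
    is a finite theta sum of Rogers-Szego type. *)
Definition binomial_theta_term (j D e : int) : K :=
  Q ^ ((j - 2 * e + D) * (j - 2 * e + D)) * (r e * r (j - e)).

Lemma binomial_theta_term_summable j D : abs_summable (binomial_theta_term j D).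
Proof.
have [M [M0 hM]] := rho_bounded Kc p1.
rewrite /binomial_theta_term; under eq_fun do rewrite mulrC.
apply: (abs_summableM (M := M * M)) => [v|]; first by rewrite normrM ler_pM.
apply: (abs_summable_inj (h := fun e => j - 2 * e + D)) abs_summable_gauss.
by move=> u v; lia.
Qed.

Definition binomial_theta j D := csum (binomial_theta_term j D).

Lemma bij_addz (c : int) : bijective (fun x : int => x + c).
Proof. by exists (fun x => x - c) => x; rewrite ?addrK ?subrK. Qed.

(** The splitting 1 - p^j = (1 - p^e) + p^e (1 - p^(j-e)) is the q-Pascal rule. Its outcome has the
    shape of [durfee_shift_rec]. *)
Lemma binomial_theta_rec j D :
  (1 - p ^ j) * binomial_theta j D = binomial_theta (j - 1) (D - 1) + Q ^ (2 * D + 2 * j - 1) * binomial_theta (j - 1) D.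
Proof.
have s := binomial_theta_term_summable; rewrite /binomial_theta -!(csumZ Kc)//.
rewrite -(csum_reindex Kc (bij_addz (-1)) (s (j - 1) (D - 1))).
rewrite -(csumD Kc); last 2 first.
- exact: abs_summable_inj (bij_inj (bij_addz (-1))) (s (j - 1) (D - 1)).
- exact: abs_summableZ.
apply: eq_csum => e; rewrite /binomial_theta_term quart_exprz.
have -> : j - 1 - (e - 1) = j - e by ring.
have -> : j - 1 - 2 * (e - 1) + (D - 1) = j - 2 * e + D by ring.
have -> : r (j - 1 - e) = (1 - Q ^ (4 * (j - e))) * r (j - e).
  by rewrite rS; congr r; ring.
rewrite -rS; set E := Q ^ ((j - _ + _) * _).
have : Q ^ (2 * D + 2 * j - 1) * Q ^ ((j - 1 - 2 * e + D) * (j - 1 - 2 * e + D))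
    = E * Q ^ (4 * e) by qpow.
rewrite [X in _ = _ + X]mulrA => ->.
have -> : Q ^ (4 * j) = Q ^ (4 * e) * Q ^ (4 * (j - e)) by qpow.
ring.
Qed.

(** The exponent [(2 v + D)^2] is [4 v (v + D) + D^2], so the Durfee identity evaluates the sum. *)
Lemma durfee_shift0 D : durfee_shift 0 D = rinf * Q ^ (D * D).
Proof.
rewrite mulrC -(durfee Kc w0 w1 D) -(csumZ Kc); last exact: durfee_summable.
apply: eq_csum => v; rewrite /durfee_shift_term /durfee_term sqr_exprz [RHS]mulrA.
by congr (_ * _); qpow.
Qed.

(** Both sides satisfy the same recurrence in j once multiplied by [1 - p ^ j], and they agree at
    [j = 0] by the Durfee identity. For negative j both vanish, since [e] and [j - e] cannot both be
    nonnegative. *)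
Lemma durfee_shift_binomial_theta j D : r j * durfee_shift j D = rinf * binomial_theta j D.
Proof.
case: j => j; last first.
  rewrite rho_lt0// mul0r /binomial_theta (@csum_single _ _ _ 0) /binomial_theta_term => [|e _].
    by rewrite [r (_ - _)]rho_lt0 ?mulr0//; lia.
  by case: e => e; [rewrite [r (_ - _)]rho_lt0 ?mulr0//; lia
                   |rewrite mul0r mulr0].
elim: j D => [|j IHj] D.
  rewrite (rho0 p) mul1r durfee_shift0; congr (_ * _).
  rewrite /binomial_theta (@csum_single _ _ _ 0) /binomial_theta_term => [|e e0].
    by rewrite subr0 rho0 !mulr1; congr (_ ^ _); ring.
  case: e e0 => [[|e]|e] e0 //; last by rewrite mul0r mulr0.
  by rewrite [r (_ - _)]rho_lt0 ?mulr0//; lia.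
have nz : 1 - p ^ j.+1%:Z != 0 by apply: subr_expz_neq0.
apply: (mulfI nz); rewrite mulrA rhoS// [in RHS]mulrCA binomial_theta_rec durfee_shift_rec.
have -> : j.+1%:Z - 1 = j by lia.
by rewrite mulrDr IHj mulrCA IHj; ring.
Qed.

(** One passage along the chain. The index j is traded for [c = j - 2 e], the difference of the two
    indices with sum j. For Gaussian [g] the new inner sum is again a [durfee_shift], so the step
    can be repeated. *)
Lemma transfer (g : int -> K) D : abs_summable g ->
  csum (fun j => g j * (r j * durfee_shift j D)) =
  rinf * csum (fun c => Q ^ ((c + D) * (c + D)) *
                        csum (fun e => r e * r (e + c) * g (2 * e + c))).
Proof.
move=> hg; have [M [M0 hM]] := rho_bounded Kc p1.
pose F j e := g j * binomial_theta_term j D e.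
have sF : abs_summable (fun x => F x.1 x.2).
  have inj : injective (fun x : int * int => (x.1, x.1 - 2 * x.2 + D)).
    by move=> [a b] [c d] /= [-> h]; congr (_, _); lia.
  have := abs_summable_inj inj (abs_summable_pair hg abs_summable_gauss).
  move=> /(abs_summableZ (M * M)); apply: abs_summable_le => -[j e] /=.
  rewrite /F /binomial_theta_term !normrM (ger0_norm M0) mulrA [leLHS]mulrC.
  by apply: ler_pM; rewrite ?mulr_ge0// ler_pM.
have bij : bijective (fun x : int * int => (2 * x.2 + x.1, x.2)).
  by exists (fun x => (x.1 - 2 * x.2, x.2)) => -[a b] /=; congr (_, _); ring.
transitivity (rinf * csum (fun x => F x.1 x.2)).
  rewrite (csum_fubini Kc sF) -(csumZ Kc); last exact: abs_summable_csum.
  apply: eq_csum => j; rewrite durfee_shift_binomial_theta /F (csumZ Kc); last exact: binomial_theta_term_summable.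
  by rewrite mulrCA.
congr (_ * _); rewrite -(csum_reindex Kc bij sF).
have sF' := abs_summable_inj (bij_inj bij) sF.
rewrite (csum_fubini Kc (F := fun c e => F (2 * e + c) e) sF').
apply: eq_csum => c.
have e1 e : F (2 * e + c) e = Q ^ ((c + D) * (c + D)) * (r e * r (e + c) * g (2 * e + c)).
  rewrite /F /binomial_theta_term.
  have -> : 2 * e + c - 2 * e + D = c + D by ring.
  have -> : 2 * e + c - e = e + c by ring.
  ring.
rewrite (eq_csum e1) csumZ//.
apply: (abs_summableM (M := M * M)) => [e|]; first by rewrite normrM ler_pM.
by apply: (abs_summable_inj (h := fun e => 2 * e + c)) hg => a b; lia.
Qed.

Definition chain_term (D v j k : int) : K :=
  Q ^ ((2 * v + D - j) * (2 * v + D - j) + (j - k) * (j - k) + k * k)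
  * (r v * r (v + D) * r j * r k).

(** The points with [x + y + z = D] are parametrized by [x = c + D], [y = - c - d], [z = d]. *)
Definition theta3 D := csum (fun c => Q ^ ((c + D) * (c + D)) *
  csum (fun d => Q ^ ((d + c) * (d + c) + d * d))).

(** [transfer] on j and then on k yields two factors [rinf]. The remaining inner sum is
    [durfee_shift 0 d], which yields the third. *)
Lemma chain_sum D :
  csum (fun j => csum (fun k => csum (fun v => chain_term D v j k))) =
  rinf ^+ 3 * theta3 D.
Proof.
have [M [M0 hM]] := rho_bounded Kc p1.
pose G j k := Q ^ ((j - k) * (j - k) + k * k) * r k.
have sG0 : abs_summable (fun x : int * int => Q ^ ((x.1 - x.2) * (x.1 - x.2) + x.2 * x.2)).
  have inj : injective (fun x : int * int => (x.1 - x.2, x.2)).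
    by move=> [a b] [c d] /= [h h']; congr (_, _); lia.
  have := abs_summable_inj inj (abs_summable_pair abs_summable_gauss abs_summable_gauss).
  by apply: abs_summable_le => -[a b] /=; rewrite expfzDr.
have sG : abs_summable (fun x => G x.1 x.2).
  rewrite /G; under eq_fun do rewrite mulrC.
  by apply: abs_summableM sG0 => x.
pose g j := csum (G j).
have sg : abs_summable g by apply: abs_summable_csum.
transitivity (csum (fun j => g j * (r j * durfee_shift j D))).
  apply: eq_csum => j; rewrite -(csumZr Kc); last exact: abs_summable_row sG.
  apply: eq_csum => k; rewrite mulrA -(csumZ Kc); last exact: durfee_shift_term_summable.
  apply: eq_csum => v; rewrite /chain_term /G /durfee_shift_term -addrA (expfzDr _ _ Q0).
  ring.
rewrite (transfer D sg) [rinf ^+ 3]exprS -[RHS]mulrA; congr (_ * _).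
have inj : injective (fun x : int * int => (x.1 + D, x.2 + x.1, x.2)).
  by move=> [a b] [c d] /= [h _ h']; congr (_, _); lia.
have sT : abs_summable (fun x : int * int => Q ^ ((x.1 + D) * (x.1 + D)) *
    Q ^ ((x.2 + x.1) * (x.2 + x.1) + x.2 * x.2)).
  have := abs_summable_inj inj (abs_summable_pair (abs_summable_pair
    abs_summable_gauss abs_summable_gauss) abs_summable_gauss).
  by apply: abs_summable_le => -[a b] /=; rewrite (expfzDr _ _ Q0) mulrA.
have e0 c : Q ^ ((c + D) * (c + D)) * csum (fun d => Q ^ ((d + c) * (d + c) + d * d)) =
    csum (fun d => Q ^ ((c + D) * (c + D)) * Q ^ ((d + c) * (d + c) + d * d)).
  rewrite csumZ//.
  have inj' : injective (fun d : int => (d + c, d)) by move=> a b [].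
  have := abs_summable_inj inj' (abs_summable_pair abs_summable_gauss abs_summable_gauss).
  by apply: abs_summable_le => d /=; rewrite (expfzDr _ _ Q0).
rewrite /theta3 -(csumZ Kc); last first.
  rewrite (_ : (fun _ => _) = fun c => csum (fun d => Q ^ ((c + D) * (c + D)) *
      Q ^ ((d + c) * (d + c) + d * d))); last exact/funext.
  exact: (abs_summable_csum Kc (F := fun c d => _) sT).
apply: eq_csum => c; rewrite mulrCA; congr (_ * _).
transitivity (csum (fun k => Q ^ (k * k) * (r k * durfee_shift k c))).
  rewrite /g.
  have sH : abs_summable (fun x : int * int => r x.1 * r (x.1 + c) * G (2 * x.1 + c) x.2).
    apply: (abs_summableM (M := M * M)) => [x|]; first by rewrite normrM ler_pM.
    apply: (abs_summable_inj (h := fun x : int * int => (2 * x.1 + c, x.2))) sG.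
    by move=> [a b] [a' b'] /= [h h']; congr (_, _); lia.
  have e1 e : r e * r (e + c) * csum (G (2 * e + c)) =
      csum (fun k => r e * r (e + c) * G (2 * e + c) k).
    by rewrite csumZ//; exact: abs_summable_row sG.
  rewrite (eq_csum e1).
  rewrite (csum_exchange Kc (F := fun e k => r e * r (e + c) * G (2 * e + c) k) sH).
  apply: eq_csum => k; rewrite mulrA -(csumZ Kc); last exact: durfee_shift_term_summable.
  apply: eq_csum => e; rewrite /G /durfee_shift_term (expfzDr _ _ Q0).
  ring.
rewrite (transfer c abs_summable_gauss) [rinf ^+ 2]expr2 -[RHS]mulrA; congr (_ * _).
rewrite -(csumZ Kc); last first.
  have inj' : injective (fun d : int => (d + c, d)) by move=> a b [].
  have := abs_summable_inj inj' (abs_summable_pair abs_summable_gauss abs_summable_gauss).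
  by apply: abs_summable_le => d /=; rewrite (expfzDr _ _ Q0).
apply: eq_csum => d; rewrite (expfzDr _ _ Q0) mulrCA -durfee_shift0; congr (_ * _).
by apply: eq_csum => e; rewrite /durfee_shift_term subr0 mulrC.
Qed.

End Convolution.

(** * A Schur-type expansion of the reciprocal Pochhammer symbol *)

Section Schur.
Variable K : numFieldType.
Hypothesis Kc : abs_complete K.
Variable Q : K.
Hypotheses (Q0 : Q != 0) (Q1 : `|Q| < 1).
Notation p := ((Q ^+ 2) ^+ 2).
Notation r := (rho p).
Notation rinf := ((qpoch_inf p p)^-1).

Let p1 : `|p| < 1. Proof. by rewrite -exprM normrX expr_lt1. Qed.

Let rS (n : int) : (1 - Q ^ (4 * n)) * r n = r (n - 1).
Proof. by rewrite -(quart_exprz Q n) rhoS. Qed.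

(** [al] and [be] are the pentagonal powers p^(r(3r-1)/2) at [r = 2 m] and [r = 2 m + 1]. *)
Let al (m : int) := Q ^ (4 * (m * (6 * m - 1))).
Let be (m : int) := Q ^ (4 * ((2 * m + 1) * (3 * m + 1))).

Let al_summable (u : int -> K) M : (forall m, `|u m| <= M) ->
  abs_summable (fun m => al m * u m).
Proof.
move=> hu; under eq_fun do rewrite mulrC; apply: (abs_summableM hu).
apply: (@abs_summable_qexp _ _ _ Q 1 (fun m => 4 * (m * (6 * m - 1)))
  0 id (fun=> 0) (fun=> 0) (fun=> 0)) => // [i j [->]//|i|i].
  by nia.
by rewrite normr_exprz mul1r.
Qed.

Let be_summable (u : int -> K) M : (forall m, `|u m| <= M) ->
  abs_summable (fun m => be m * u m).
Proof.
move=> hu; under eq_fun do rewrite mulrC; apply: (abs_summableM hu).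
apply: (@abs_summable_qexp _ _ _ Q 1 (fun m => 4 * ((2 * m + 1) * (3 * m + 1)))
  4 id (fun=> 0) (fun=> 0) (fun=> 0)) => // [i j [->]//|i|i].
  by nia.
by rewrite normr_exprz mul1r.
Qed.

Let rr_bounded : exists M, forall a b, `|r a * r b| <= M.
Proof.
have [M [M0 hM]] := rho_bounded Kc p1.
by exists (M * M) => a b; rewrite normrM ler_pM.
Qed.

Let ala (a b : int -> int) : abs_summable (fun m => al m * (r (a m) * r (b m))).
Proof. by have [M hM] := rr_bounded; apply: (al_summable (M := M)). Qed.

Let bea (a b : int -> int) : abs_summable (fun m => be m * (r (a m) * r (b m))).
Proof. by have [M hM] := rr_bounded; apply: (be_summable (M := M)). Qed.

(** Up to the factor [r (2 * i)] for [a_] and [r (2 * i + 1)] for [b_], the sums over m are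
    alternating sums of Gaussian binomials that turn out to equal 1. *)
Let a_ (i m : int) := al m * (r (i - 3 * m) * r (i + 3 * m))
  - be m * (r (i - 3 * m - 1) * r (i + 3 * m + 1)).
Let b_ (i m : int) := al m * (r (i + 1 - 3 * m) * r (i + 3 * m))
  - be m * (r (i - 3 * m - 1) * r (i + 3 * m + 2)).

Let a_summable i : abs_summable (a_ i).
Proof.
exact: abs_summableB (ala (fun m => i - 3 * m) (fun m => i + 3 * m))
  (bea (fun m => i - 3 * m - 1) (fun m => i + 3 * m + 1)).
Qed.

Let b_summable i : abs_summable (b_ i).
Proof.
exact: abs_summableB (ala (fun m => i + 1 - 3 * m) (fun m => i + 3 * m))
  (bea (fun m => i - 3 * m - 1) (fun m => i + 3 * m + 2)).
Qed.

(** [pascal1] and [pascal2] are the two q-Pascal rules, one for each way of splitting 1 -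
    p^(x+y). *)
Let pascal1 (n x y : int) : n = x + y ->
  (1 - Q ^ (4 * n)) * (r x * r y) =
  r (x - 1) * r y + Q ^ (4 * x) * (r x * r (y - 1)).
Proof.
by move=> ->; rewrite mulrDr expfzDr// -!rS; ring.
Qed.

Let pascal2 (n x y : int) : n = x + y ->
  (1 - Q ^ (4 * n)) * (r x * r y) =
  r x * r (y - 1) + Q ^ (4 * y) * (r (x - 1) * r y).
Proof.
by move=> ->; rewrite mulrDr expfzDr// -!rS; ring.
Qed.

(** With [pascal1] on the [al] part and [pascal2] on the [be] part, the unwanted terms are [t m] and
    [t (m + 1)], which telescope. *)
Let step_b i : (1 - Q ^ (4 * (2 * i + 1))) * csum (b_ i) = csum (a_ i).
Proof.
pose t m := Q ^ (4 * (m * (6 * m - 1) + i + 1 - 3 * m))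
  * (r (i + 1 - 3 * m) * r (i + 3 * m - 1)).
have st : abs_summable t.
  have [M hM] := rr_bounded; rewrite /t; under eq_fun do rewrite mulrC.
  apply: abs_summableM => [m|]; first exact: hM.
  apply: (@abs_summable_qexp _ _ _ Q 1 (fun m => 4 * (m * (6 * m - 1) + i + 1 - 3 * m))
    (16 + 4 * `|i|) id (fun=> 0) (fun=> 0) (fun=> 0)) => // [m n [->]//|m|m].
    by nia.
  by rewrite normr_exprz mul1r.
have st' := abs_summable_inj (bij_inj (bij_addz 1)) st.
have e m : (1 - Q ^ (4 * (2 * i + 1))) * b_ i m = a_ i m + (t m - t (m + 1)).
  rewrite /b_ /a_ mulrBr (mulrCA _ (al m)) (mulrCA _ (be m)).
  rewrite (@pascal1 _ (i + 1 - 3 * m) (i + 3 * m)); last by ring.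
  rewrite (@pascal2 _ (i - 3 * m - 1) (i + 3 * m + 2)); last by ring.
  rewrite (_ : i + 1 - 3 * m - 1 = i - 3 * m); last by ring.
  rewrite (_ : i + 3 * m + 2 - 1 = i + 3 * m + 1); last by ring.
  rewrite /t /al /be (_ : i + 1 - 3 * (m + 1) = i - 3 * m - 1 - 1); last by ring.
  rewrite (_ : i + 3 * (m + 1) - 1 = i + 3 * m + 2); last by ring.
  have -> : Q ^ (4 * (m * (6 * m - 1) + i + 1 - 3 * m)) =
      Q ^ (4 * (m * (6 * m - 1))) * Q ^ (4 * (i + 1 - 3 * m)) by qpow.
  have -> : Q ^ (4 * ((m + 1) * (6 * (m + 1) - 1) + i + 1 - 3 * (m + 1))) =
      Q ^ (4 * ((2 * m + 1) * (3 * m + 1))) * Q ^ (4 * (i + 3 * m + 2)) by qpow.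
  ring.
rewrite -(csumZ Kc)// (eq_csum e) (csumD Kc)//; last exact: abs_summableB.
have e1 : csum (fun m : int => t (m + 1)) = csum t := csum_reindex Kc (bij_addz 1) st.
by rewrite (csumB Kc st st') e1 subrr addr0.
Qed.

(** Here the unwanted terms cancel for each m: they share the product
    [r (i - 3 * m) * r (i + 1 + 3 * m)], and their powers of Q coincide. *)
Let step_a i : (1 - Q ^ (4 * (2 * i + 2))) * csum (a_ (i + 1)) = csum (b_ i).
Proof.
rewrite -(csumZ Kc)//; apply: eq_csum => m.
rewrite /b_ /a_ mulrBr (mulrCA _ (al m)) (mulrCA _ (be m)).
rewrite (@pascal2 _ (i + 1 - 3 * m) (i + 1 + 3 * m)); last by ring.
rewrite (@pascal1 _ (i + 1 - 3 * m - 1) (i + 1 + 3 * m + 1)); last by ring.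
rewrite (_ : i + 1 + 3 * m - 1 = i + 3 * m); last by ring.
rewrite (_ : i + 1 - 3 * m - 1 = i - 3 * m); last by ring.
rewrite (_ : i + 1 + 3 * m + 1 - 1 = i + 1 + 3 * m); last by ring.
rewrite (_ : i + 1 + 3 * m + 1 = i + 3 * m + 2); last by ring.
have : Q ^ (4 * ((2 * m + 1) * (3 * m + 1))) * Q ^ (4 * (i - 3 * m)) =
  Q ^ (4 * (m * (6 * m - 1))) * Q ^ (4 * (i + 1 + 3 * m)) by qpow.
rewrite -/(be m) -/(al m) => h; apply/eqP; rewrite -subr_eq0; apply/eqP.
transitivity ((al m * Q ^ (4 * (i + 1 + 3 * m)) - be m * Q ^ (4 * (i - 3 * m)))
  * (r (i - 3 * m) * r (i + 1 + 3 * m))); first by ring.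
by rewrite h subrr mul0r.
Qed.

Let rr0 (x y : int) : x + y < 0 -> r x * r y = 0.
Proof.
by case: (ltP x 0) => [/rho_lt0->|x0 h]; rewrite ?mul0r// [r y]rho_lt0 ?mulr0//; lia.
Qed.

Let schur_nat (i : nat) : csum (a_ i) = r (2 * i%:Z) /\ csum (b_ i) = r (2 * i%:Z + 1).
Proof.
have ab j : 0 <= j -> csum (a_ j) = r (2 * j) -> csum (b_ j) = r (2 * j + 1).
  move=> j0 h; have nz : 1 - p ^ (2 * j + 1) != 0 by apply: subr_expz_neq0 => //; lia.
  apply: (mulfI nz); rewrite rhoS// quart_exprz step_b h; congr r; ring.
suff h : csum (a_ i) = r (2 * i%:Z) by split=> //; apply: ab.
elim: i => [|i IHi].
  rewrite mulr0 rho0 (@csum_single _ _ _ 0) /a_ /al => [|m m0].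
    by rewrite !mulr0 [r (_ - 1)]rho_lt0// !mul0r !mulr0 !subr0 ?expr0z (rho0 p) !mul1r.
  have [hm|hm] : m < 0 \/ 0 < m by lia.
    rewrite [r (0 + 3 * m)]rho_lt0 ?[r (0 + 3 * m + 1)]rho_lt0 ?mulr0 ?subr0//; lia.
  rewrite [r (0 - 3 * m)]rho_lt0 ?[r (0 - 3 * m - 1)]rho_lt0 ?mul0r ?mulr0 ?subr0//; lia.
have nz : 1 - p ^ (2 * i%:Z + 2) != 0 by apply: subr_expz_neq0 => //; lia.
apply: (mulfI nz); rewrite quart_exprz (_ : i.+1%:Z = i%:Z + 1) ?step_a; last by lia.
rewrite (ab _ _ IHi)// -quart_exprz (_ : 2 * (i%:Z + 1) = 2 * i%:Z + 2) ?rhoS//; last by ring.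
by congr r; ring.
Qed.

Lemma schur_even i : csum (a_ i) = r (2 * i).
Proof.
case: i => i; first by have [] := schur_nat i.
rewrite [RHS]rho_lt0// (@csum_single _ _ _ 0) => [|m _]; rewrite /a_.
  by rewrite !rr0 ?mulr0 ?subr0//; lia.
by rewrite !rr0 ?mulr0 ?subr0//; lia.
Qed.

Lemma schur_odd i : csum (b_ i) = r (2 * i + 1).
Proof.
case: i => i; first by have [] := schur_nat i.
rewrite [RHS]rho_lt0; last by lia.
rewrite (@csum_single _ _ _ 0) => [|m _]; rewrite /b_.
  by rewrite !rr0 ?mulr0 ?subr0//; lia.
by rewrite !rr0 ?mulr0 ?subr0//; lia.
Qed.

(** [alpha] and [beta] are the coefficients of the expansion of [rho] at [r = 2 m] and
    [r = 2 m + 1], with [3 r + 1] equal to [6 m + 1] and [6 m + 4]; the sign (-1)^r is absorbed in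
    [beta]. *)
Definition alpha (m : int) : K := al m * (1 - Q ^ (4 * (6 * m + 1))).
Definition beta (m : int) : K := be m * (Q ^ (4 * (6 * m + 4)) - 1).

Lemma alpha_summable : abs_summable alpha.
Proof.
rewrite /alpha; under eq_fun do rewrite mulrBr mulr1; apply: abs_summableB.
  have := al_summable (u := fun=> 1) (M := 1).
  by under eq_fun do rewrite mulr1; apply => m; rewrite normr1.
have h := be_summable (u := fun=> 1) (M := 1) (fun=> ltac:(by rewrite normr1)).
apply: abs_summable_le h => m; rewrite mulr1 /al /be.
suff -> : Q ^ (4 * (m * (6 * m - 1))) * Q ^ (4 * (6 * m + 1)) =
  Q ^ (4 * ((2 * m + 1) * (3 * m + 1))) by [].
by qpow.
Qed.

Lemma beta_summable : abs_summable beta.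
Proof.
rewrite /beta; under eq_fun do rewrite mulrBr mulr1; apply: abs_summableB; last first.
  have := be_summable (u := fun=> 1) (M := 1).
  by under eq_fun do rewrite mulr1; apply => m; rewrite normr1.
have h := al_summable (u := fun=> 1) (M := 1) (fun=> ltac:(by rewrite normr1)).
apply: abs_summable_le (abs_summable_inj (bij_inj (bij_addz 1)) h) => m /=.
rewrite mulr1 /al /be.
suff -> : Q ^ (4 * ((2 * m + 1) * (3 * m + 1))) * Q ^ (4 * (6 * m + 4)) =
  Q ^ (4 * ((m + 1) * (6 * (m + 1) - 1))) by [].
by qpow.
Qed.

(** Since 1 - p^D = (1 - p^y) - p^D (1 - p^x), one product with index sum n + 1 replaces two
    neighbouring Schur terms with index sum n. The coefficients match because r(3r-1)/2 + 3r + 1 is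
    the next pentagonal exponent. *)
Let expand (D x y : int) : y = x + D ->
  (1 - Q ^ (4 * D)) * (r x * r y) = r x * r (y - 1) - Q ^ (4 * D) * (r (x - 1) * r y).
Proof. by move=> ->; rewrite -!rS mulrDr expfzDr//; ring. Qed.

Lemma rho_even i : r (2 * i) =
  csum (fun m => alpha m * (r (i - 3 * m) * r (i - 3 * m + (6 * m + 1)))).
Proof.
rewrite -schur_even; apply: eq_csum => m; rewrite /alpha -mulrA expand// /a_ mulrBr.
congr (_ * (_ * r _) - _); first by ring.
rewrite [RHS]mulrA /al /be.
have -> : Q ^ (4 * (m * (6 * m - 1))) * Q ^ (4 * (6 * m + 1)) =
  Q ^ (4 * ((2 * m + 1) * (3 * m + 1))) by qpow.
by congr (_ * (_ * r _)); ring.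
Qed.

Lemma rho_odd i : r (2 * i + 1) =
  csum (fun m => beta m * (r (i - (3 * m + 1)) * r (i - (3 * m + 1) + (6 * m + 4)))).
Proof.
rewrite -schur_odd.
have s1 := ala (fun m => i + 1 - 3 * m) (fun m => i + 3 * m).
have s2 := bea (fun m => i - 3 * m - 1) (fun m => i + 3 * m + 2).
have s1' := abs_summable_inj (bij_inj (bij_addz 1)) s1.
(* The [al] sum is shifted because [be m], at [r = 2 m + 1], pairs with the next exponent
   [r = 2 m + 2], that of [al (m + 1)]. *)
rewrite /b_ (csumB Kc)// -(csum_reindex Kc (bij_addz 1) s1) -(csumB Kc)//.
apply: eq_csum => m; set x := i - (3 * m + 1); set y := x + _.
rewrite [RHS](_ : _ = - (be m * ((1 - Q ^ (4 * (6 * m + 4))) * (r x * r y)))); last first.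
  by rewrite /beta; ring.
rewrite expand// mulrBr opprB [X in _ = X - _]mulrA /al /be.
have -> : Q ^ (4 * ((2 * m + 1) * (3 * m + 1))) * Q ^ (4 * (6 * m + 4)) =
  Q ^ (4 * ((m + 1) * (6 * (m + 1) - 1))) by qpow.
by congr (_ * (r _ * r _) - _ * (r _ * r _)); rewrite /y /x; ring.
Qed.

(* With [q = Q ^+ 2], the summands of the two triple sums are
   [Q^-1 * sigma 0] and [Q ^- 2 * sigma 1]. *)
Definition sigma (eps : int) (x : int * int * int) : K :=
  let: (i, j, k) := x in
  Q ^ ((2 * i + eps + 1 - j) * (2 * i + eps + 1 - j) + (j - k) * (j - k) + k * k)
  * (r (2 * i + eps) * r j * r k).

Let gauss3_summable (I : choiceType) (a b c : I -> int) :
  injective (fun x => (a x, b x, c x)) ->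
  abs_summable (fun x => Q ^ (a x * a x + b x * b x + c x * c x)).
Proof.
move=> inj; have g := abs_summable_gauss Q0 Q1.
have := abs_summable_inj inj (abs_summable_pair (abs_summable_pair g g) g).
by apply: abs_summable_le => x /=; rewrite !(expfzDr _ _ Q0).
Qed.

Lemma sigma_summable eps : abs_summable (sigma eps).
Proof.
have [M [M0 hM]] := rho_bounded Kc p1.
have inj : injective (fun x : int * int * int =>
    (2 * x.1.1 + eps + 1 - x.1.2, x.1.2 - x.2, x.2)).
  by move=> [[a b] c] [[a' b'] c'] /= [h1 h2 h3]; congr (_, _, _); lia.
apply: abs_summable_le (abs_summableZ (M * M * M) (gauss3_summable inj)) => -[[i j] k] /=.
rewrite /sigma mulrC !normrM (ger0_norm M0) ler_wpM2r//.
by rewrite !ler_pM// mulr_ge0.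
Qed.

Let chain_summable D : abs_summable (fun x : int * int * int => chain_term Q D x.2 x.1.1 x.1.2).
Proof.
have [M [M0 hM]] := rho_bounded Kc p1.
have inj : injective (fun x : int * int * int =>
    (2 * x.2 + D - x.1.1, x.1.1 - x.1.2, x.1.2)).
  by move=> [[a b] c] [[a' b'] c'] /= [h1 h2 h3]; congr (_, _, _); lia.
apply: abs_summable_le (abs_summableZ (M * M * M * M) (gauss3_summable inj)) => -[[j k] v] /=.
rewrite /chain_term mulrC !normrM (ger0_norm M0) ler_wpM2r//.
by rewrite !ler_pM// ?mulr_ge0.
Qed.

(** Serves both parities. Putting [v = i - c m] and [D = 2 * c m + eps + 1] turns
    [2 * i + eps + 1 - j] into [2 * v + D - j], so each term of the expansion is a [chain_term] in
    which v runs over all integers. *)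
Lemma sigma_sum (eps : int) (c : int -> int) (g : int -> K) :
  abs_summable g ->
  (forall i, r (2 * i + eps) =
    csum (fun m => g m * (r (i - c m) * r (i - c m + (2 * c m + eps + 1))))) ->
  csum (sigma eps) = csum (fun m => g m * (rinf ^+ 3 * theta3 Q (2 * c m + eps + 1))).
Proof.
move=> sg hg; have [M [M0 hM]] := rho_bounded Kc p1.
pose H m (x : int * int * int) :=
  g m * chain_term Q (2 * c m + eps + 1) (x.1.1 - c m) x.1.2 x.2.
have inj : injective (fun x : int * int * int =>
    (2 * x.1.1 + eps + 1 - x.1.2, x.1.2 - x.2, x.2)).
  by move=> [[a b] k] [[a' b'] k'] /= [h1 h2 h3]; congr (_, _, _); lia.
have sH : abs_summable (fun x => H x.1 x.2).
  apply: abs_summable_le (abs_summableZ (M * M * M * M) (abs_summable_pair sg (gauss3_summable inj))).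
  move=> -[m [[i j] k]] /=; rewrite /H /chain_term !normrM (ger0_norm M0) /=.
  have -> : 2 * (i - c m) + (2 * c m + eps + 1) - j = 2 * i + eps + 1 - j by ring.
  rewrite [leLHS]mulrA [leLHS]mulrC ler_wpM2r ?mulr_ge0//.
  by rewrite !ler_pM// ?mulr_ge0.
have tE D (j k v : int) : chain_term Q D v j k = Q ^ ((2 * v + D - j) * (2 * v + D - j)
  + (j - k) * (j - k) + k * k) * (r j * r k) * (r v * r (v + D)).
  by rewrite /chain_term; ring.
transitivity (csum (fun x => csum (fun m => H m x))).
  apply: eq_csum => -[[i j] k]; rewrite /sigma hg mulrAC -mulrA mulrA.
  rewrite [RHS](_ : _ = csum (fun m => Q ^ ((2 * i + eps + 1 - j) * (2 * i + eps + 1 - j)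
    + (j - k) * (j - k) + k * k) * (r j * r k) * (g m * (r (i - c m) * r (i - c m + (2 * c m + eps + 1)))))).
    rewrite csumZ//; first by ring.
    under eq_fun do rewrite mulrC.
    by apply: (abs_summableM (M := M * M)) => // m; rewrite normrM ler_pM.
  apply: eq_csum => m; rewrite /H tE /=.
  have -> : 2 * (i - c m) + (2 * c m + eps + 1) - j = 2 * i + eps + 1 - j by ring.
  by rewrite mulrCA.
rewrite -(csum_exchange Kc sH); apply: eq_csum => m.
have st := chain_summable (2 * c m + eps + 1).
have bij : bijective (fun x : int * int * int => (x.1.2, x.2, x.1.1 - c m)).
  by exists (fun x => (x.2 + c m, x.1.1, x.1.2)) => -[[a b] d] /=; rewrite ?addrK ?subrK.
rewrite /H (csumZ Kc); last exact: abs_summable_inj (bij_inj bij) st.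
rewrite (csum_reindex Kc bij st) -(chain_sum Kc Q0 Q1).
rewrite (csum_fubini Kc (F := fun x v => chain_term Q _ v x.1 x.2) st).
have := abs_summable_csum Kc (F := fun x v => chain_term Q _ v x.1 x.2) st.
by move=> /(csum_fubini Kc (F := fun j k => csum (fun v => chain_term Q _ v j k))) ->.
Qed.

End Schur.

(** * Theta functions *)

(** Expanding [(|c| - k)^2 >= 0] trades a square for a linear bound in [|c|], as the majorants
    require. *)
Lemma sqr_lower_bound (k c : int) : 2 * k * `|c| - k * k <= c * c.
Proof.
have h : 0 <= (`|c| - k) * (`|c| - k) by rewrite -expr2 sqr_ge0.
have e : `|c| * `|c| = c * c by rewrite -normrM ger0_norm// -expr2 sqr_ge0.
have -> : c * c = (`|c| - k) * (`|c| - k) + 2 * k * `|c| - k * k by rewrite -e; ring.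
lia.
Qed.

Section Thetas.
Variable K : numFieldType.
Hypothesis Kc : abs_complete K.

Lemma csum_mod3 (f : int * int -> K) : abs_summable f ->
  csum f = csum (fun x : int * int => f (3 * x.1, x.2))
    + csum (fun x : int * int => f (3 * x.1 + 1, x.2))
    + csum (fun x : int * int => f (3 * x.1 + 2, x.2)).
Proof.
move=> sf; pose g (s : int) x := if (x.1 %% 3)%Z == s then f x else 0.
have sg s : abs_summable (g s).
  by apply: abs_summable_le sf => x; rewrite /g; case: ifP; rewrite ?normr0.
have fE x : f x = g 0 x + g 1 x + g 2 x.
  rewrite /g; do 3!case: eqP => ?; rewrite ?addr0 ?add0r//; exfalso; lia.
have gE (s : int) : 0 <= s -> s < 3 ->
    csum (g s) = csum (fun x : int * int => f (3 * x.1 + s, x.2)).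
  move=> s0 s3; pose h (x : int * int) := (3 * x.1 + s, x.2).
  rewrite -(@csum_inj _ Kc _ _ h)//.
  - apply: eq_csum => x; rewrite /g /h /=.
    by rewrite mulrC modzMDl modz_small ?eqxx// s0.
  - by move=> [a b] [a' b'] [h1 h2]; congr (_, _) => //; lia.
  - move=> [a b] hab; rewrite /g /=; case: eqP => // as3.
    have /eqP[] := hab ((a %/ 3)%Z, b); rewrite /h /=; congr (_, _); lia.
rewrite (eq_csum fE) !(csumD Kc)//; last exact: abs_summableD.
rewrite !gE//; congr (_ + _ + _); apply: eq_csum => x; by rewrite addr0.
Qed.

Variable Q : K.
Hypotheses (Q0 : Q != 0) (Q1 : `|Q| < 1).

Lemma abs_summable_gauss2 (I : choiceType) (a b : I -> int) (e : I -> int) (C : int) :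
  injective (fun x => (a x, b x)) ->
  (forall x, `|a x| + `|b x| - C <= e x) -> abs_summable (fun x => Q ^ e x).
Proof.
move=> inj he; apply: (@abs_summable_qexp _ _ _ Q 1 e C a b (fun=> 0) (fun=> 0)) => //.
- by move=> x y [h1 h2]; apply: inj; rewrite h1 h2.
- by move=> x; rewrite !normr0 !addr0.
- by move=> x; rewrite mul1r normr_exprz.
Qed.

(** With [q = Q ^+ 2], [cubic] is q^(-1/3) times the Borwein cubic theta function c(q). *)
Definition cubic_exp (c d : int) : int := c * c + c * d + d * d + c.
Definition cubic := csum (fun x : int * int => Q ^ (2 * cubic_exp x.1 x.2)).

Let cubic_summable : abs_summable (fun x : int * int => Q ^ (2 * cubic_exp x.1 x.2)).
Proof.
apply: (@abs_summable_gauss2 _ fst snd _ 8) => [[a b] [c d] //|[c d]] /=.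
have h1 : 0 <= (c + d) * (c + d) by rewrite -expr2 sqr_ge0.
have h2 := sqr_lower_bound 2 c; have h3 := sqr_lower_bound 1 d.
have -> : 2 * cubic_exp c d = (c + d) * (c + d) + (c * c + 2 * c) + d * d.
  by rewrite /cubic_exp; ring.
by lia.
Qed.

(** Subtracting n from each of x, y, z reduces the sum [3 n + 1] to 1 and lowers the sum of squares
    by [3 n^2 + 2 n]. *)
Lemma theta3E n : theta3 Q (3 * n + 1) = Q ^ (3 * n * n + 2 * n + 1) * cubic.
Proof.
pose f (x : int * int) := Q ^ (3 * n * n + 2 * n + 1) * Q ^ (2 * cubic_exp x.1 x.2).
have sf : abs_summable f by exact: abs_summableZ.
(* The translation by n of x, y, z, read in the coordinates [x = c + 3 n + 1] before, [x = c + 1]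
   after, and [z = d]. *)
have bij : bijective (fun x : int * int => (x.1 + 2 * n, x.2 - n)).
  by exists (fun x => (x.1 - 2 * n, x.2 + n)) => -[a b] /=; congr (_, _); ring.
rewrite /cubic -(csumZ Kc)// -/f -(csum_reindex Kc bij sf).
rewrite (csum_fubini Kc (F := fun c d => f (c + 2 * n, d - n)));
  last exact: abs_summable_inj (bij_inj bij) sf.
apply: eq_csum => c; rewrite -(csumZ Kc); last first.
  apply: (@abs_summable_gauss2 _ id (fun=> 0) _ 1) => [a b []//|d] /=.
  have h1 : 0 <= (d + c) * (d + c) by rewrite -expr2 sqr_ge0.
  by have h2 := sqr_lower_bound 1 d; lia.
by apply: eq_csum => d; rewrite /f /cubic_exp /=; qpow.
Qed.

(** This is [cubic_exp] at [c = m + 2 n], [d = m - n], the general pair with [c - d] divisible by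
    3. *)
Definition cubic0_exp (m n : int) : int := 3 * (m * m + m * n + n * n) + m + 2 * n.
Definition cubic0 := csum (fun x : int * int => Q ^ (2 * cubic0_exp x.1 x.2)).

Let cubic0_summable : abs_summable (fun x : int * int => Q ^ (2 * cubic0_exp x.1 x.2)).
Proof.
apply: (@abs_summable_gauss2 _ fst snd _ 12) => [[a b] [c d] //|[c d]] /=.
have h1 : 0 <= (c + d) * (c + d) by rewrite -expr2 sqr_ge0.
have h2 := sqr_lower_bound 1 c; have h3 := sqr_lower_bound 1 d.
have -> : 2 * cubic0_exp c d =
    3 * ((c + d) * (c + d)) + (3 * (c * c) + 2 * c) + (3 * (d * d) + 4 * d).
  by rewrite /cubic0_exp; ring.
by lia.
Qed.

(* The order-three rotation [(c, d) -> (d - 1, - c - d)] preserves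
   [cubic_exp] and permutes the classes of [c - d] modulo 3. *)
Lemma cubic_cubic0 : cubic = 3 * cubic0.
Proof.
have bij : bijective (fun x : int * int => (x.2 + x.1, x.2)).
  by exists (fun x => (x.1 - x.2, x.2)) => -[a b] /=; congr (_, _); ring.
rewrite /cubic -(csum_reindex Kc bij cubic_summable).
rewrite csum_mod3; last exact: abs_summable_inj (bij_inj bij) cubic_summable.
have e0 : csum (fun x : int * int => Q ^ (2 * cubic_exp (x.2 + 3 * x.1) x.2)) = cubic0.
  have b0 : bijective (fun x : int * int => (x.2 + x.1, x.1)).
    by exists (fun x => (x.2, x.1 - x.2)) => -[a b] /=; congr (_, _); ring.
  rewrite /cubic0 -(csum_reindex Kc b0 cubic0_summable); apply: eq_csum => x.
  by rewrite /cubic_exp /cubic0_exp /=; qpow.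
have e1 : csum (fun x : int * int => Q ^ (2 * cubic_exp (x.2 + (3 * x.1 + 1)) x.2)) = cubic0.
  have b0 : bijective (fun x : int * int => (- x.2 - 2 * x.1 - 1, x.2 + x.1)).
    by exists (fun x => (- x.1 - x.2 - 1, x.1 + 2 * x.2 + 1)) => -[a b] /=; congr (_, _); ring.
  rewrite /cubic0 -(csum_reindex Kc b0 cubic0_summable); apply: eq_csum => x.
  by rewrite /cubic_exp /cubic0_exp /=; qpow.
have e2 : csum (fun x : int * int => Q ^ (2 * cubic_exp (x.2 + (3 * x.1 + 2)) x.2)) = cubic0.
  have b0 : bijective (fun x : int * int => (x.1 + 1, - x.2 - 2 * x.1 - 2)).
    by exists (fun x => (x.1 - 1, - x.2 - 2 * x.1)) => -[a b] /=; congr (_, _); ring.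
  rewrite /cubic0 -(csum_reindex Kc b0 cubic0_summable); apply: eq_csum => x.
  by rewrite /cubic_exp /cubic0_exp /=; qpow.
by rewrite /= e0 e1 e2; ring.
Qed.

(** Exponents of the triple product with base [Q ^+ 6] and [z = Q ^+ (2 * b)]; the cases b = 0, 1, 2
    are used together. *)
Definition theta_exp (b n : int) : int := 3 * (n * n - n) + 2 * b * n.

Let theta_summable b : abs_summable (fun n : int => Q ^ theta_exp b n).
Proof.
apply: (@abs_summable_gauss2 _ id (fun=> 0) _ ((`|b| + 3) ^+ 2)) => [m n []//|n].
by rewrite /theta_exp; nia.
Qed.

Let slice (N : int) := csum (fun x : int * int =>
  Q ^ (theta_exp 0 (N - x.1 - x.2) + theta_exp 1 x.1 + theta_exp 2 x.2)).

Let slice_summable N : abs_summable (fun x : int * int =>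
  Q ^ (theta_exp 0 (N - x.1 - x.2) + theta_exp 1 x.1 + theta_exp 2 x.2)).
Proof.
have h := abs_summable_pair (theta_summable 1) (theta_summable 2).
apply: (@abs_summable_le _ _ _ (fun x => 1 * (Q ^ theta_exp 1 x.1 * Q ^ theta_exp 2 x.2))).
  move=> x; rewrite -addrA (expfzDr (theta_exp 0 _) _ Q0) mul1r.
  rewrite -[in leRHS](expfzDr _ _ Q0) normrM ler_piMl// normr_exprz.
  have h0 n : 0 <= theta_exp 0 n by rewrite /theta_exp; nia.
  by have := ler_exprz_norm Q0 Q1 (h0 (N - x.1 - x.2)); rewrite expr0z.
exact: abs_summableZ.
Qed.

(* Cyclic shift of the three summation indices, one of them moved by 1. *)
Let sliceS N : slice (N + 1) = Q ^ (2 * N) * slice N.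
Proof.
have bij : bijective (fun x : int * int => (N - x.1 - x.2, x.1)).
  by exists (fun x => (x.2, N - x.1 - x.2)) => -[a b] /=; congr (_, _); ring.
rewrite /slice -(csum_reindex Kc bij (slice_summable (N + 1))) -(csumZ Kc)//.
by apply: eq_csum => x; rewrite /theta_exp /=; qpow.
Qed.

Let sliceE N : slice N = Q ^ (N * N - N) * cubic0.
Proof.
have s0 : slice 0 = cubic0.
  by apply: eq_csum => x; rewrite /theta_exp /cubic0_exp; congr (_ ^ _); ring.
have [n [->|->]] : exists n : nat, N = n \/ N = - n%:Z by exists `|N|%N; lia.
  elim: n => [|n IHn]; first by rewrite mulr0 expr0z mul1r s0.
  rewrite -addn1 PoszD sliceS IHn mulrA; congr (_ * _); qpow.
elim: n => [|n IHn]; first by rewrite oppr0 mulr0 expr0z mul1r s0.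
have nz : Q ^ (2 * (- n.+1%:Z)) != 0 by rewrite expfz_neq0.
apply: (mulfI nz); rewrite -sliceS (_ : - n.+1%:Z + 1 = - n%:Z); last by lia.
rewrite IHn mulrA; congr (_ * _); rewrite -expfzDr//; congr (_ ^ _); lia.
Qed.

(** The product of the three series is grouped by the sum N of their indices. Each [slice] is a
    power of Q times [cubic0], so a two-variable theta series is expressed through one-variable
    ones. *)
Lemma theta_product :
  csum (fun n : int => Q ^ theta_exp 0 n) * csum (fun n : int => Q ^ theta_exp 1 n)
  * csum (fun n : int => Q ^ theta_exp 2 n)
  = cubic0 * csum (fun n : int => Q ^ (n * n - n)).
Proof.
set f0 := fun n : int => Q ^ theta_exp 0 n; set f1 := fun n : int => Q ^ theta_exp 1 n.
set f2 := fun n : int => Q ^ theta_exp 2 n.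
have s12 := abs_summable_pair (theta_summable 1) (theta_summable 2).
have s := abs_summable_pair (theta_summable 0) s12.
have -> : csum f0 * csum f1 * csum f2 = csum (fun x : int * (int * int) =>
    Q ^ theta_exp 0 x.1 * (Q ^ theta_exp 1 x.2.1 * Q ^ theta_exp 2 x.2.2)).
  rewrite (csum_fubini Kc (F := fun n y => Q ^ theta_exp 0 n * (Q ^ theta_exp 1 y.1 * Q ^ theta_exp 2 y.2)) s).
  rewrite -mulrA -(csumZr Kc); last exact: theta_summable.
  apply: eq_csum => n; rewrite (csumZ Kc)//; congr (_ * _).
  rewrite (csum_fubini Kc (F := fun n y => Q ^ theta_exp 1 n * Q ^ theta_exp 2 y) s12).
  rewrite -(csumZr Kc); last exact: theta_summable.
  by apply: eq_csum => m; rewrite (csumZ Kc)//; exact: theta_summable.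
have bij : bijective (fun x : int * (int * int) => (x.1 - x.2.1 - x.2.2, x.2)).
  by exists (fun x => (x.1 + x.2.1 + x.2.2, x.2)) => -[a [b c]] /=; congr (_, _); ring.
rewrite -(csum_reindex Kc bij s).
have s' := abs_summable_inj (bij_inj bij) s.
rewrite (csum_fubini Kc (F := fun N y => Q ^ theta_exp 0 (N - y.1 - y.2) * (Q ^ theta_exp 1 y.1 * Q ^ theta_exp 2 y.2)) s').
rewrite -(csumZ Kc); last first.
  apply: (@abs_summable_gauss2 _ id (fun=> 0) _ 4) => [m n []//|n].
  by nia.
apply: eq_csum => N; rewrite mulrC -sliceE; apply: eq_csum => x.
by rewrite -!expfzDr// addrA.
Qed.

Let sgnM (a b : int) : (-1 : K) ^ (a + b) = (-1) ^ a * (-1) ^ b.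
Proof. by rewrite expfzDr// oppr_eq0 oner_eq0. Qed.

Let sgn2 (a : int) : (-1 : K) ^ (2 * a) = 1.
Proof. by rewrite -exprz_exp -exprnP sqrrN expr1n exp1rz. Qed.

Let sgnE (a b : int) : (exists k, a = b + 2 * k) -> (-1 : K) ^ a = (-1) ^ b.
Proof. by move=> [k ->]; rewrite sgnM sgn2 mulr1. Qed.

Let sgnN (a b : int) : (exists k, a = b + 1 + 2 * k) -> (-1 : K) ^ a = - (-1) ^ b.
Proof. by move=> [k ->]; rewrite !sgnM sgn2 mulr1 expr1z mulrN1. Qed.

Let norm_sgn (a : int) : `|(-1 : K) ^ a| = 1.
Proof. by rewrite normr_exprz normrN1 exp1rz. Qed.

Let csum_antisym (I : choiceType) (f : I -> K) (h : I -> I) :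
  bijective h -> abs_summable f -> (forall x, f (h x) = - f x) -> csum f = 0.
Proof.
move=> bh sf hf; have := csum_reindex Kc bh sf.
rewrite (eq_csum hf) (csumN Kc)// => /eqP; rewrite eq_sym -addr_eq0 -mulr2n.
by rewrite mulrn_eq0/= => /eqP.
Qed.

(** Euler's pentagonal series in [Q ^+ 4]; [penta3] is the one in [Q ^+ 12]. *)
Definition penta (n : int) : K := (-1) ^ n * Q ^ (6 * n * n - 2 * n).

Lemma penta_summable : abs_summable penta.
Proof.
apply: (@abs_summable_qexp _ _ _ Q 1 (fun n => 6 * n * n - 2 * n) 6 id (fun=> 0) (fun=> 0)
  (fun=> 0)) => // [i j [->]//|i|i]; first by have := sqr_lower_bound 1 i; nia.
by rewrite normrM norm_sgn normr_exprz.
Qed.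

Definition penta3 (n : int) : K := (-1) ^ n * Q ^ (18 * n * n - 6 * n).

Lemma penta3_summable : abs_summable penta3.
Proof.
apply: (@abs_summable_qexp _ _ _ Q 1 (fun n => 18 * n * n - 6 * n) 18 id (fun=> 0) (fun=> 0)
  (fun=> 0)) => // [i j [->]//|i|i]; first by have := sqr_lower_bound 1 i; nia.
by rewrite normrM norm_sgn normr_exprz.
Qed.

(** With [q = Q ^+ 2], the sums for b = 1 and b = 2 are the theta products [Jbar q 4 12] and
    [Jbar q 2 12]. *)
Definition hexa (b n : int) : K := Q ^ (12 * n * n + 4 * b * n).

Lemma hexa_summable b : abs_summable (hexa b).
Proof.
apply: (@abs_summable_gauss2 _ id (fun=> 0) _ ((2 * `|b| + 3) ^+ 2)) => [m n []//|n].
by nia.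
Qed.

Let quint_summable (e : int -> int) C : (forall n, `|n| - C <= e n) ->
  abs_summable (fun n => Q ^ e n).
Proof.
move=> h; apply: (@abs_summable_gauss2 _ id (fun=> 0) _ C) => [m n []//|n].
by rewrite normr0 addr0.
Qed.

Let csum_prod (f g : int -> K) : abs_summable f -> abs_summable g ->
  csum f * csum g = csum (fun x => f x.1 * g x.2).
Proof.
move=> sf sg; have sfg := abs_summable_pair sf sg.
rewrite (csum_fubini Kc (F := fun a b => f a * g b) sfg) -(csumZr Kc)//.
by apply: eq_csum => a; rewrite (csumZ Kc).
Qed.

Let even1 : abs_summable (fun m : int => Q ^ (36 * m * m)).
Proof. by apply: (quint_summable (C := 36)) => n; have := sqr_lower_bound 1 n; nia. Qed.

Let even2 : abs_summable (fun m : int => Q ^ (36 * m * m + (24 * m + 4))).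
Proof. by apply: (quint_summable (C := 100)) => n; have := sqr_lower_bound 1 n; nia. Qed.

Let odd1 : abs_summable (fun m : int => Q ^ (36 * m * m + 36 * m + 8)).
Proof. by apply: (quint_summable (C := 100)) => n; have := sqr_lower_bound 1 n; nia. Qed.

Let odd2 : abs_summable (fun m : int => Q ^ (36 * m * m + 36 * m + 8 + (24 * m + 16))).
Proof. by apply: (quint_summable (C := 100)) => n; have := sqr_lower_bound 1 n; nia. Qed.

Let evenE m : Q ^ (36 * m * m) * (1 - Q ^ (24 * m + 4)) =
  Q ^ (36 * m * m) - Q ^ (36 * m * m + (24 * m + 4)).
Proof. by rewrite mulrBr mulr1 -expfzDr. Qed.

Let oddE m : Q ^ (36 * m * m + 36 * m + 8) * (Q ^ (24 * m + 16) - 1) =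
  Q ^ (36 * m * m + 36 * m + 8 + (24 * m + 16)) - Q ^ (36 * m * m + 36 * m + 8).
Proof. by rewrite mulrBr mulr1 -expfzDr. Qed.

Lemma quint_even_summable :
  abs_summable (fun m : int => Q ^ (36 * m * m) * (1 - Q ^ (24 * m + 4))).
Proof. by under eq_fun do rewrite evenE; apply: abs_summableB. Qed.

Lemma quint_odd_summable : abs_summable
  (fun m : int => Q ^ (36 * m * m + 36 * m + 8) * (Q ^ (24 * m + 16) - 1)).
Proof. by under eq_fun do rewrite oddE; apply: abs_summableB. Qed.

(* The exponents on the two sides are the forms [a^2 + 2 b^2] and
   [3 (a^2 + 2 b^2)].  Multiplication by [1 + sqrt (-2)] and its conjugate
   carry the second lattice onto two of the three classes of [a + b] modulo 3
   in the first, and the third class cancels in pairs. *)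
Lemma quintuple_even : csum penta * csum (hexa 1) =
  csum penta3 * csum (fun m : int => Q ^ (36 * m * m) * (1 - Q ^ (24 * m + 4))).
Proof.
rewrite (eq_csum evenE) (csumB Kc even1 even2).
have p3 := penta3_summable; have sh := hexa_summable 1.
rewrite mulrBr !csum_prod//; last exact: penta_summable.
have sf := abs_summable_pair penta_summable sh.
have bij : bijective (fun x : int * int => (x.1 - x.2, x.2)).
  by exists (fun x => (x.1 + x.2, x.2)) => -[a b] /=; congr (_, _); ring.
rewrite -(csum_reindex Kc bij sf).
have sf' := abs_summable_inj (bij_inj bij) sf.
rewrite (csum_mod3 sf') /=.
have -> : csum (fun x : int * int => penta (3 * x.1 + 2 - x.2) * hexa 1 x.2) = 0.
  (* This reflection preserves the total exponent and moves the index of [penta] by the odd number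
     [2 b - 2 m - 1], which reverses the sign. *)
  have bh : bijective (fun x : int * int => (x.1, 2 * x.1 + 1 - x.2)).
    by exists (fun x => (x.1, 2 * x.1 + 1 - x.2)) => -[a b] /=; congr (_, _); ring.
  apply: (csum_antisym bh).
    apply: (abs_summable_inj (h := fun x : int * int => (3 * x.1 + 2, x.2))) sf'.
    by move=> [a b] [a' b'] [h1 h2]; congr (_, _) => //; lia.
  move=> [m b]; rewrite /penta /hexa /= -!mulrA -!expfzDr// -[RHS]mulNr.
  congr (_ * _ ^ _); last by ring.
  by apply: sgnN; exists (b - m - 1); ring.
rewrite addr0; congr (_ + _).
  have bh : bijective (fun x : int * int => (x.1 - x.2, - x.1)).
    by exists (fun x => (- x.2, - x.2 - x.1)) => -[a b] /=; congr (_, _); ring.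
  rewrite -(csum_reindex Kc bh (abs_summable_pair p3 even1)); apply: eq_csum => -[m b] /=.
  rewrite /penta /hexa /penta3 -!mulrA -!expfzDr//; congr (_ * _ ^ _); last by ring.
  by apply: sgnE; exists m; ring.
have bh : bijective (fun x : int * int => (x.2 - x.1, x.1)).
  by exists (fun x => (x.2, x.1 + x.2)) => -[a b] /=; congr (_, _); ring.
have s := abs_summable_pair p3 even2.
rewrite -(csum_reindex Kc bh s) -(csumN Kc); last exact: abs_summable_inj (bij_inj bh) s.
apply: eq_csum => -[m b] /=.
rewrite /penta /hexa /penta3 -!mulrA -!expfzDr// -[RHS]mulNr; congr (_ * _ ^ _); last by ring.
by apply: sgnN; exists (2 * m - b); ring.
Qed.

(* As above, with the classes of [a - b]. *)
Lemma quintuple_odd : csum penta * csum (hexa 2) =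
  csum penta3 * csum (fun m : int => Q ^ (36 * m * m + 36 * m + 8) * (Q ^ (24 * m + 16) - 1)).
Proof.
rewrite (eq_csum oddE) (csumB Kc odd2 odd1).
have p3 := penta3_summable; have sh := hexa_summable 2.
rewrite mulrBr !csum_prod//; last exact: penta_summable.
have sf := abs_summable_pair penta_summable sh.
have bij : bijective (fun x : int * int => (x.2 + x.1, x.2)).
  by exists (fun x => (x.1 - x.2, x.2)) => -[a b] /=; congr (_, _); ring.
rewrite -(csum_reindex Kc bij sf).
have sf' := abs_summable_inj (bij_inj bij) sf.
rewrite (csum_mod3 sf') /=.
have -> : csum (fun x : int * int => penta (x.2 + (3 * x.1 + 1)) * hexa 2 x.2) = 0.
  have bh : bijective (fun x : int * int => (x.1, - 2 * x.1 - 1 - x.2)).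
    by exists (fun x => (x.1, - 2 * x.1 - 1 - x.2)) => -[a b] /=; congr (_, _); ring.
  apply: (csum_antisym bh).
    apply: (abs_summable_inj (h := fun x : int * int => (3 * x.1 + 1, x.2))) sf'.
    by move=> [a b] [a' b'] [h1 h2]; congr (_, _) => //; lia.
  move=> [m b]; rewrite /penta /hexa /= -!mulrA -!expfzDr// -[RHS]mulNr.
  congr (_ * _ ^ _); last by ring.
  by apply: sgnN; exists (- m - 1 - b); ring.
rewrite addr0; congr (_ + _).
  have bh : bijective (fun x : int * int => (- x.2 - x.1, x.1 - 1)).
    by exists (fun x => (x.2 + 1, - x.2 - 1 - x.1)) => -[a b] /=; congr (_, _); ring.
  rewrite -(csum_reindex Kc bh (abs_summable_pair p3 odd2)); apply: eq_csum => -[m b] /=.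
  rewrite /penta /hexa /penta3 -!mulrA -!expfzDr//; congr (_ * _ ^ _); last by ring.
  by apply: sgnE; exists (b + 2 * m); ring.
have bh : bijective (fun x : int * int => (x.2 + x.1 + 1, - x.1 - 1)).
  by exists (fun x => (- x.2 - 1, x.1 + x.2)) => -[a b] /=; congr (_, _); ring.
have s := abs_summable_pair p3 odd1.
rewrite -(csum_reindex Kc bh s) -(csumN Kc); last exact: abs_summable_inj (bij_inj bh) s.
apply: eq_csum => -[m b] /=.
rewrite /penta /hexa /penta3 -!mulrA -!expfzDr// -[RHS]mulNr; congr (_ * _ ^ _); last by ring.
by apply: sgnN; exists m; ring.
Qed.

End Thetas.

(** * Infinite product evaluations of the theta series *)

Section Products.
Variable K : numFieldType.
Hypothesis Kc : abs_complete K.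
Lemma qpoch_split3 (a p : K) n : qpoch a p (3 * n) =
  qpoch a (p ^+ 3) n * qpoch (a * p) (p ^+ 3) n * qpoch (a * p ^+ 2) (p ^+ 3) n.
Proof.
elim: n => [|n IHn]; first by rewrite muln0 /qpoch !big_nil !mulr1.
rewrite mulnS addnC addn3 !qpochS IHn -!exprM.
have -> : p ^+ (3 * n).+1 = p * p ^+ (3 * n) by rewrite exprS.
have -> : p ^+ (3 * n).+2 = p ^+ 2 * p ^+ (3 * n) by rewrite -exprD.
by move: (p ^+ (3 * n)) => x; ring.
Qed.

(** Limit of the finite splitting, with the product on the right taken along multiples of 3. *)
Lemma qpoch_inf_split3 (w a : K) : w != 0 -> `|w| < 1 -> a != 0 ->
  qpoch_inf a (w ^+ 6) * qpoch_inf (a * w ^+ 2) (w ^+ 6)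
    * qpoch_inf (a * w ^+ 4) (w ^+ 6) = qpoch_inf a (w ^+ 2).
Proof.
move=> w0 w1 a0; have w30 : w ^+ 3 != 0 by rewrite expf_neq0.
have w31 : `|w ^+ 3| < 1 by rewrite normrX expr_lt1.
have e6 : (w ^+ 3) ^+ 2 = w ^+ 6 by rewrite -exprM.
have aw n : a * w ^+ n != 0 by rewrite mulf_neq0 ?expf_neq0.
have c1 := qpoch_cvg Kc w30 w31 a0; have c2 := qpoch_cvg Kc w30 w31 (aw 2%N).
have c3 := qpoch_cvg Kc w30 w31 (aw 4%N).
have c0 := qpoch_cvg Kc w0 w1 a0.
have sub : (fun n => 3 * n)%N @ \oo --> \oo.
  by move=> A [N _ NA]; exists N => // n /= Nn; apply: NA => /=; lia.
have cs := cvg_comp _ _ sub c0; rewrite !e6 in c1 c2 c3.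
have c123 : (fun n => qpoch a (w ^+ 6) n * qpoch (a * w ^+ 2) (w ^+ 6) n *
    qpoch (a * w ^+ 4) (w ^+ 6) n) @ \oo -->
    qpoch_inf a (w ^+ 6) * qpoch_inf (a * w ^+ 2) (w ^+ 6) * qpoch_inf (a * w ^+ 4) (w ^+ 6).
  by apply: cvgM => //; apply: cvgM.
have e : (fun n => qpoch a (w ^+ 6) n * qpoch (a * w ^+ 2) (w ^+ 6) n *
    qpoch (a * w ^+ 4) (w ^+ 6) n) = qpoch a (w ^+ 2) \o (fun n => 3 * n)%N.
  by apply/funext => n /=; rewrite qpoch_split3 -!exprM.
rewrite e in c123.
exact: (cvg_unique (@norm_hausdorff _ K) c123 cs).
Qed.

End Products.

Section Products1.
Variable K : numFieldType.
Hypothesis Kc : abs_complete K.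
Variable Q : K.
Hypotheses (Q0 : Q != 0) (Q1 : `|Q| < 1).

Let Qn0 n : Q ^+ n != 0. Proof. exact: expf_neq0. Qed.
Let Qn1 n : `|Q ^+ n.+1| < 1. Proof. by rewrite normrX expr_lt1. Qed.
Let QnM m n : (Q ^+ m) ^+ n = Q ^+ (m * n). Proof. by rewrite exprM. Qed.
Let Qnz (n : nat) (m : int) : (Q ^+ n) ^ m = Q ^ (n%:Z * m).
Proof. by rewrite exprnP exprz_exp. Qed.

(** Euler's pentagonal number theorem: [jacobi] at [w = Q ^+ 6], [z = - Q ^+ 4] gives the three
    residue classes that [qpoch_inf_split3] merges. *)
Lemma penta_sum : csum (penta Q) = qpoch_inf (Q ^+ 4) (Q ^+ 4).
Proof.
have z0 : - Q ^+ 4 != 0 by rewrite oppr_eq0.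
have := jacobi Kc (Qn0 6) (Qn1 5) z0.
rewrite opprK QnM invrN mulrN opprK.
have -> : Q ^+ 12 / Q ^+ 4 = Q ^+ 4 * Q ^+ 4 by rewrite -(exprD Q 4 4) (exprD Q 8 4) mulfK.
have := @qpoch_inf_split3 K Kc (Q ^+ 2) (Q ^+ 4) (Qn0 2) (Qn1 1) (Qn0 4).
rewrite !QnM -!exprD => <- <-; apply: eq_csum => n.
have -> : (- Q ^+ 4) ^ n = (-1) ^ n * Q ^ (4 * n) by rewrite -[- Q ^+ 4]mulN1r (expfzMl (- 1) (Q ^+ 4)) Qnz.
by rewrite /penta Qnz mulrCA; congr (_ * _); qpow.
Qed.

End Products1.

Section Products2.
Variable K : numFieldType.
Hypothesis Kc : abs_complete K.
Variable Q : K.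
Hypotheses (Q0 : Q != 0) (Q1 : `|Q| < 1).

Let Qn0 n : Q ^+ n != 0. Proof. exact: expf_neq0. Qed.
Let Qn1 n : `|Q ^+ n.+1| < 1. Proof. by rewrite normrX expr_lt1. Qed.
Let QnM m n : (Q ^+ m) ^+ n = Q ^+ (m * n). Proof. by rewrite exprM. Qed.
Let Qnz (n : nat) (m : int) : (Q ^+ n) ^ m = Q ^ (n%:Z * m).
Proof. by rewrite exprnP exprz_exp. Qed.

Lemma penta3_sum : csum (penta3 Q) = qpoch_inf (Q ^+ 12) (Q ^+ 12).
Proof.
have := penta_sum Kc (Qn0 3) (Qn1 2); rewrite QnM => <-.
apply: eq_csum => n; rewrite /penta /penta3 Qnz; congr (_ * _); qpow.
Qed.

Lemma hexa1_sum : csum (hexa Q 1) = qpoch_inf (- Q ^+ 8) (Q ^+ 24)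
  * qpoch_inf (- Q ^+ 16) (Q ^+ 24) * qpoch_inf (Q ^+ 24) (Q ^+ 24).
Proof.
have := jacobi Kc (Qn0 12) (Qn1 11) (Qn0 16); rewrite QnM.
have -> : Q ^+ 24 / Q ^+ 16 = Q ^+ 8 by rewrite (exprD Q 8 16) mulfK.
rewrite [qpoch_inf (- Q ^+ 16) _ * _]mulrC => <-; apply: eq_csum => n.
by rewrite /hexa !Qnz; qpow.
Qed.

Lemma hexa2_sum : csum (hexa Q 2) = qpoch_inf (- Q ^+ 4) (Q ^+ 24)
  * qpoch_inf (- Q ^+ 20) (Q ^+ 24) * qpoch_inf (Q ^+ 24) (Q ^+ 24).
Proof.
have := jacobi Kc (Qn0 12) (Qn1 11) (Qn0 20); rewrite QnM.
have -> : Q ^+ 24 / Q ^+ 20 = Q ^+ 4 by rewrite (exprD Q 4 20) mulfK.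
rewrite [qpoch_inf (- Q ^+ 20) _ * _]mulrC => <-; apply: eq_csum => n.
by rewrite /hexa !Qnz; qpow.
Qed.

Let theta_sum b : csum (fun n : int => Q ^ theta_exp b%:Z n) =
  qpoch_inf (- Q ^+ (2 * b)) (Q ^+ 6) * qpoch_inf (- (Q ^+ 6 / Q ^+ (2 * b))) (Q ^+ 6)
  * qpoch_inf (Q ^+ 6) (Q ^+ 6).
Proof.
have := jacobi Kc (Qn0 3) (Qn1 2) (Qn0 (2 * b)); rewrite QnM => <-.
by apply: eq_csum => n; rewrite /theta_exp !Qnz PoszM; qpow.
Qed.

Let neg_neq1 a k : a = 1 \/ `|a| < 1 -> (- a) * (Q ^+ 2) ^+ k != 1.
Proof.
have q1 : `|Q ^+ 2| < 1 by exact: Qn1.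
case=> [->|a1].
  case: k => [|k]; first by rewrite expr0 mulr1 -subr_eq0 -opprD oppr_eq0 -mulr2n pnatr_eq0.
  apply: contraTneq q1 => h; have : `|Q ^+ 2| ^+ k.+1 = 1.
    by rewrite -normrX -normrN -mulN1r h normr1.
  by move=> h2; rewrite -(@expr_lt1 _ k.+1)// h2 ltxx.
apply: contraTneq a1 => h.
have : `|a| * `|Q ^+ 2| ^+ k = 1 by rewrite -normrX -normrM -normrN -mulNr h normr1.
move=> h2; apply/negP => a1; have : `|a| * `|Q ^+ 2| ^+ k < 1.
  by apply: le_lt_trans a1; rewrite ler_piMr// exprn_ile1// ltW.
by rewrite h2 ltxx.
Qed.

(** In [theta_product] the factors with negative arguments merge by [qpoch_inf_split3] into (-1;
    Q^2)_oo (-Q^2; Q^2)_oo, which also occurs on the right. It is nonzero and cancels. *)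
Lemma cubic0_sum :
  cubic0 Q = qpoch_inf (Q ^+ 6) (Q ^+ 6) ^+ 3 / qpoch_inf (Q ^+ 2) (Q ^+ 2).
Proof.
have N0 n : - Q ^+ n != 0 by rewrite oppr_eq0.
have := theta_product Kc Q0 Q1.
rewrite (theta_sum 0) (theta_sum 1) (theta_sum 2) muln0 muln1 expr0 divr1.
have -> : Q ^+ 6 / Q ^+ 2 = Q ^+ 4 by rewrite (exprD Q 4 2) mulfK.
have -> : Q ^+ 6 / Q ^+ (2 * 2) = Q ^+ 2 by rewrite (exprD Q 2 4) mulfK.
have -> : csum (fun n : int => Q ^ (n * n - n)) = qpoch_inf (- 1) (Q ^+ 2)
    * qpoch_inf (- Q ^+ 2) (Q ^+ 2) * qpoch_inf (Q ^+ 2) (Q ^+ 2).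
  have := jacobi Kc Q0 Q1 (oner_neq0 K); rewrite divr1 => <-.
  by apply: eq_csum => n; rewrite exp1rz mulr1.
have := @qpoch_inf_split3 K Kc Q (- 1) Q0 Q1 (N0 0%N); rewrite !mulN1r.
have := @qpoch_inf_split3 K Kc Q (- Q ^+ 2) Q0 Q1 (N0 2%N); rewrite !mulNr -!exprD.
have n1 : qpoch_inf (- 1) (Q ^+ 2) != 0.
  by apply: qpoch_inf_neq0 => // k; apply: neg_neq1; left.
have n2 : qpoch_inf (- Q ^+ 2) (Q ^+ 2) != 0.
  by apply: qpoch_inf_neq0 => // k; apply: neg_neq1; right; apply: Qn1.
have n3 : qpoch_inf (Q ^+ 2) (Q ^+ 2) != 0.
  by apply: qpoch_inf_neq0 => // k; apply: expr_neq1; apply: Qn1.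
move: n1 n2; set A := qpoch_inf (- 1) _; set B := qpoch_inf (- Q ^+ 2) (Q ^+ 2).
move=> n1 n2 eB eA h; apply: (mulIf n3); rewrite divfK//.
apply: (mulIf (mulf_neq0 n1 n2)); rewrite -mulrA [_ * (A * B)]mulrC -h.
rewrite -eA -eB /=; ring.
Qed.

Let nz n : qpoch_inf (Q ^+ (n.+1 * 2)) (Q ^+ (n.+1 * 2)) != 0.
Proof.
rewrite exprM; apply: qpoch_inf_neq0 => //; first by rewrite !expf_neq0.
by move=> k; apply: expr_neq1; rewrite -exprM; apply: Qn1.
Qed.

Let n1 : qpoch_inf (Q ^+ 2) (Q ^+ 2) != 0 := nz 0.
Let n2 : qpoch_inf (Q ^+ 4) (Q ^+ 4) != 0 := nz 1.
Let n6 : qpoch_inf (Q ^+ 12) (Q ^+ 12) != 0 := nz 5.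

(** The chain gives [R ^+ 3] and the quintuple product returns one factor (Q^4; Q^4)_oo, hence the
    square of J_2 in the denominator. *)
Lemma sigma_even_sum : Q^-1 * csum (sigma Q 0) =
  3 * (qpoch_inf (Q ^+ 6) (Q ^+ 6) ^+ 3 *
    (qpoch_inf (- Q ^+ 8) (Q ^+ 24) * (qpoch_inf (- Q ^+ 16) (Q ^+ 24)
      * qpoch_inf (Q ^+ 24) (Q ^+ 24)))
  / (qpoch_inf (Q ^+ 2) (Q ^+ 2) * qpoch_inf (Q ^+ 4) (Q ^+ 4) ^+ 2
      * qpoch_inf (Q ^+ 12) (Q ^+ 12))).
Proof.
rewrite (sigma_sum Kc Q0 Q1 (c := fun m => 3 * m) (alpha_summable Q0 Q1)); last first.
  move=> i; rewrite addr0 (rho_even Kc Q0 Q1); apply: eq_csum => m.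
  by congr (_ * (_ * rho _ _)); ring.
set R := (qpoch_inf _ _)^-1.
(* Here [r = 2 m]: the exponents [4 m (6 m - 1)] from [alpha] and [12 m^2 + 4 m + 1] from [theta3E]
   add up to [36 m^2 + 1]. *)
rewrite (@eq_csum _ _ _ (fun m => (R ^+ 3 * cubic Q * Q) *
    (Q ^ (36 * m * m) * (1 - Q ^ (24 * m + 4))))); last first.
  move=> m; rewrite (_ : 2 * (3 * m) + 0 + 1 = 3 * (2 * m) + 1); last by ring.
  rewrite (theta3E Kc Q0 Q1) /alpha.
  have -> : Q ^ (3 * (2 * m) * (2 * m) + 2 * (2 * m) + 1) =
    Q * Q ^ (12 * m * m + 4 * m) by rewrite -{2}[Q]expr1z; qpow.
  have -> : Q ^ (36 * m * m) = Q ^ (4 * (m * (6 * m - 1))) * Q ^ (12 * m * m + 4 * m) by qpow.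
  have -> : 4 * (6 * m + 1) = 24 * m + 4 by ring.
  ring.
rewrite (csumZ Kc); last exact: quint_even_summable.
rewrite (cubic_cubic0 Kc Q0 Q1) cubic0_sum.
have := quintuple_even Kc Q0 Q1; rewrite penta_sum// penta3_sum hexa1_sum.
set U := csum _ => hU; have {hU} -> : U = qpoch_inf (Q ^+ 4) (Q ^+ 4) *
  (qpoch_inf (- Q ^+ 8) (Q ^+ 24) * qpoch_inf (- Q ^+ 16) (Q ^+ 24) *
      qpoch_inf (Q ^+ 24) (Q ^+ 24)) / qpoch_inf (Q ^+ 12) (Q ^+ 12).
  by rewrite hU mulrC mulKf.
by rewrite /R QnM; field; rewrite n1 n2 n6 Q0.
Qed.

Lemma sigma_odd_sum : Q ^- 2 * csum (sigma Q 1) =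
  3 * (qpoch_inf (Q ^+ 6) (Q ^+ 6) ^+ 3 *
    (qpoch_inf (- Q ^+ 4) (Q ^+ 24) * (qpoch_inf (- Q ^+ 20) (Q ^+ 24)
      * qpoch_inf (Q ^+ 24) (Q ^+ 24)))
  / (qpoch_inf (Q ^+ 2) (Q ^+ 2) * qpoch_inf (Q ^+ 4) (Q ^+ 4) ^+ 2
      * qpoch_inf (Q ^+ 12) (Q ^+ 12))).
Proof.
rewrite (sigma_sum Kc Q0 Q1 (c := fun m => 3 * m + 1) (beta_summable Q0 Q1)); last first.
  move=> i; rewrite (rho_odd Kc Q0 Q1); apply: eq_csum => m.
  by congr (_ * (_ * rho _ _)); ring.
set R := (qpoch_inf _ _)^-1.
(* Here [r = 2 m + 1]: the exponents [4 (2 m + 1) (3 m + 1)] and [12 m^2 + 16 m + 6] add up to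
   [36 m^2 + 36 m + 8], plus 2. *)
rewrite (@eq_csum _ _ _ (fun m => (R ^+ 3 * cubic Q * Q ^+ 2) *
    (Q ^ (36 * m * m + 36 * m + 8) * (Q ^ (24 * m + 16) - 1)))); last first.
  move=> m; rewrite (_ : 2 * (3 * m + 1) + 1 + 1 = 3 * (2 * m + 1) + 1); last by ring.
  rewrite (theta3E Kc Q0 Q1) /beta.
  have -> : Q ^ (36 * m * m + 36 * m + 8) =
    Q ^ (4 * ((2 * m + 1) * (3 * m + 1))) * Q ^ (12 * m * m + 16 * m + 4) by qpow.
  have -> : Q ^ (3 * (2 * m + 1) * (2 * m + 1) + 2 * (2 * m + 1) + 1) =
    Q ^+ 2 * Q ^ (12 * m * m + 16 * m + 4) by rewrite exprnP; qpow.
  have -> : 4 * (6 * m + 4) = 24 * m + 16 by ring.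
  ring.
rewrite (csumZ Kc); last exact: quint_odd_summable.
rewrite (cubic_cubic0 Kc Q0 Q1) cubic0_sum.
have := quintuple_odd Kc Q0 Q1; rewrite penta_sum// penta3_sum hexa2_sum.
set U := csum _ => hU; have {hU} -> : U = qpoch_inf (Q ^+ 4) (Q ^+ 4) *
  (qpoch_inf (- Q ^+ 4) (Q ^+ 24) * qpoch_inf (- Q ^+ 20) (Q ^+ 24) *
      qpoch_inf (Q ^+ 24) (Q ^+ 24)) / qpoch_inf (Q ^+ 12) (Q ^+ 12).
  by rewrite hU mulrC mulKf.
by rewrite /R QnM; field; rewrite n1 n2 n6 Q0.
Qed.

End Products2.

(** * The two identities *)

Definition summand_even (K : numFieldType) (q : K) (ijk : nat * nat * nat) : K :=
  let: (i, j, k) := ijk in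
  q ^ (2 * i%:Z ^+ 2 + j%:Z ^+ 2 + k%:Z ^+ 2 - 2 * i%:Z * j%:Z - j%:Z * k%:Z
       + 2 * i%:Z - j%:Z)
  / (qpoch (q ^+ 2) (q ^+ 2) (2 * i) * qpoch (q ^+ 2) (q ^+ 2) j
     * qpoch (q ^+ 2) (q ^+ 2) k).

Definition summand_odd (K : numFieldType) (q : K) (ijk : nat * nat * nat) : K :=
  let: (i, j, k) := ijk in
  q ^ (2 * i%:Z ^+ 2 + j%:Z ^+ 2 + k%:Z ^+ 2 - 2 * i%:Z * j%:Z - j%:Z * k%:Z
       + 4 * i%:Z - 2 * j%:Z + 1)
  / (qpoch (q ^+ 2) (q ^+ 2) (2 * i + 1) * qpoch (q ^+ 2) (q ^+ 2) j
     * qpoch (q ^+ 2) (q ^+ 2) k).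

Section Main.
Variable K : numFieldType.

Section NonZero.
Hypothesis Kc : abs_complete K.
Variable Q : K.
Hypotheses (Q0 : Q != 0) (Q1 : `|Q| < 1).

Let h (x : nat * nat * nat) : int * int * int := (x.1.1%:Z, x.1.2%:Z, x.2%:Z).

Let h_inj : injective h.
Proof. by move=> [[a b] c] [[a' b'] c'] [-> -> ->]. Qed.

Let sigma_out (eps : int) x : 0 <= eps -> eps < 2 -> (forall i, h i != x) ->
  sigma Q eps x = 0.
Proof.
move=> e0 e2; case: x => [[i j] k] hx; rewrite /sigma.
(* [eps < 2] ensures that [2 * i + eps] is negative whenever i is. *)
have [i0|i0] := ltP i 0; first by rewrite [rho _ (2 * i + eps)]rho_lt0 ?mul0r ?mulr0//; lia.
have [j0|j0] := ltP j 0; first by rewrite [rho _ j]rho_lt0// mulr0 mul0r mulr0.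
have [k0|k0] := ltP k 0; first by rewrite [rho _ k]rho_lt0// !mulr0.
have /eqP[] := hx (`|i|%N, `|j|%N, `|k|%N).
by rewrite /h /= !gez0_abs.
Qed.

Let has_sum_sigma (eps : int) (c : K) : 0 <= eps -> eps < 2 ->
  has_sum (fun x => c * sigma Q eps (h x)) (c * csum (sigma Q eps)).
Proof.
move=> e0 e2; apply: has_sumZ; apply/(has_sum_inj _ h_inj) => [x|].
  exact: sigma_out.
by apply: (csumP Kc); apply: sigma_summable.
Qed.

Let QnM m n : (Q ^+ m) ^+ n = Q ^+ (m * n). Proof. by rewrite exprM. Qed.

Lemma has_sum_even : has_sum (summand_even (Q ^+ 2))
  (3 * (J (Q ^+ 2) 3 ^+ 3 * Jbar (Q ^+ 2) 4 12 /
        (J (Q ^+ 2) 1 * J (Q ^+ 2) 2 ^+ 2 * J (Q ^+ 2) 6))).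
Proof.
rewrite /J /Jbar /qpochs_inf !big_cons big_nil mulr1.
rewrite (_ : 12%:Z - 4%:Z = 8%:Z)// -exprnP !QnM.
rewrite (_ : 3 * _ = Q^-1 * csum (sigma Q 0)); last exact/esym/(sigma_even_sum Kc Q0 Q1).
have -> : summand_even (Q ^+ 2) = fun x => Q^-1 * sigma Q 0 (h x).
  apply/funext => -[[i j] k]; rewrite /summand_even /sigma /h.
  have -> : rho (Q ^+ 2 ^+ 2) (2 * i%:Z + 0) =
      (qpoch (Q ^+ 2 ^+ 2) (Q ^+ 2 ^+ 2) (2 * i))^-1.
    by rewrite (_ : 2 * i%:Z + 0 = (2 * i)%N%:Z)//; lia.
  rewrite sqr_exprz [RHS]mulrA !invfM; congr (_ * _).
  rewrite [Q^-1](_ : _ = Q ^ (-1)%Z) -?expfzDr//; congr (_ ^ _); ring.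
by apply: has_sum_sigma.
Qed.

Lemma has_sum_odd : has_sum (summand_odd (Q ^+ 2))
  (3 * (J (Q ^+ 2) 3 ^+ 3 * Jbar (Q ^+ 2) 2 12 /
        (J (Q ^+ 2) 1 * J (Q ^+ 2) 2 ^+ 2 * J (Q ^+ 2) 6))).
Proof.
rewrite /J /Jbar /qpochs_inf !big_cons big_nil mulr1.
rewrite (_ : 12%:Z - 2%:Z = 10%:Z)// -exprnP !QnM.
rewrite (_ : 3 * _ = Q ^- 2 * csum (sigma Q 1)); last exact/esym/(sigma_odd_sum Kc Q0 Q1).
have -> : summand_odd (Q ^+ 2) = fun x => Q ^- 2 * sigma Q 1 (h x).
  apply/funext => -[[i j] k]; rewrite /summand_odd /sigma /h.
  have -> : rho (Q ^+ 2 ^+ 2) (2 * i%:Z + 1) =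
      (qpoch (Q ^+ 2 ^+ 2) (Q ^+ 2 ^+ 2) (2 * i + 1))^-1.
    by rewrite (_ : 2 * i%:Z + 1 = (2 * i + 1)%N%:Z)//; lia.
  rewrite [Q ^- 2](_ : _ = Q ^ (-2)%Z)// sqr_exprz [RHS]mulrA !invfM.
  by congr (_ * _); rewrite -?expfzDr//; congr (_ ^ _); ring.
by apply: has_sum_sigma.
Qed.

End NonZero.

(** * The case of q equal to 0 *)

Section Zero.

Lemma qpoch_0 n : qpoch (0 : K) 0 n = 1.
Proof. by rewrite /qpoch big1// => i _; rewrite mul0r subr0. Qed.

Lemma qpoch_inf_0 : qpoch_inf (0 : K) 0 = 1.
Proof.
apply: cvg_lim; first exact: norm_hausdorff.
by rewrite (_ : qpoch 0 0 = fun=> 1); [exact: cvg_cst|apply/funext => n; exact: qpoch_0].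
Qed.

Let Qn0 n : (0 : K) ^+ n.+1 = 0. Proof. by rewrite expr0n. Qed.

(** Each of x, y, z is 0, 1 or -1; replacing squares by absolute values makes the equations linear
    for [lia]. *)
Let sum3_le2 (x y z : int) : x * x + y * y + z * z <= 2 ->
  x * x = `|x| /\ y * y = `|y| /\ z * z = `|z|.
Proof.
have le1 (u : int) : u * u <= 2 -> u * u = `|u|.
  move=> hu; have hb := sqr_lower_bound 2 u.
  by have [->|[->|->]] : u = 0 \/ u = 1 \/ u = - 1 by lia.
have sq0 (u : int) : 0 <= u * u by rewrite -expr2 sqr_ge0.
have := sq0 x; have := sq0 y; have := sq0 z => hz hy hx h.
by split; [|split]; apply: le1; lia.
Qed.

Let exp0 (e : int) : (0 : K) ^ e = (e == 0)%:R.
Proof. exact: exp0rz. Qed.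

Let A_even : {fset nat * nat * nat} :=
  [fset (0, 0, 0); (0, 1, 0); (0, 1, 1)]%N%fset.
Let A_odd : {fset nat * nat * nat} :=
  [fset (0, 1, 0); (0, 1, 1); (0, 2, 1)]%N%fset.

(** All Pochhammer symbols are 1, so only exponent 0 survives. Twice the exponent plus 1 is a sum of
    three squares, hence that sum must be 1; in the odd case it must be 2. Three triples remain,
    which matches the right-hand value 3. *)
Lemma summand_even0 ijk : summand_even (0 : K) ijk = (ijk \in A_even)%:R.
Proof.
case: ijk => -[i j] k; rewrite /summand_even Qn0 !qpoch_0 !mulr1 invr1 mulr1 exp0.
congr ((nat_of_bool _)%:R); apply/eqP/idP; last first.
  by rewrite !inE !xpair_eqE => /orP[/orP[]|] /andP[/andP[/eqP -> /eqP ->] /eqP ->].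
move=> e0; have h : (2 * i%:Z + 1 - j%:Z) * (2 * i%:Z + 1 - j%:Z)
    + (j%:Z - k%:Z) * (j%:Z - k%:Z) + k%:Z * k%:Z = 1.
  by rewrite -[RHS](addr0 1) -[X in 1 + X](mulr0 2) -e0; ring.
have [|h1 [h2 h3]] := @sum3_le2 (2 * i%:Z + 1 - j%:Z) (j%:Z - k%:Z) k%:Z.
  by rewrite h.
rewrite h1 h2 h3 in h.
have : (i = 0 /\ j = 0 /\ k = 0 \/ i = 0 /\ j = 1 /\ k = 0 \/ i = 0 /\ j = 1 /\ k = 1)%N.
  by lia.
by case=> [|[]] [-> [-> ->]]; rewrite !inE !xpair_eqE.
Qed.

Lemma summand_odd0 ijk : summand_odd (0 : K) ijk = (ijk \in A_odd)%:R.
Proof.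
case: ijk => -[i j] k; rewrite /summand_odd Qn0 !qpoch_0 !mulr1 invr1 mulr1 exp0.
congr ((nat_of_bool _)%:R); apply/eqP/idP; last first.
  by rewrite !inE !xpair_eqE => /orP[/orP[]|] /andP[/andP[/eqP -> /eqP ->] /eqP ->].
move=> e0; have h : (2 * i%:Z + 2 - j%:Z) * (2 * i%:Z + 2 - j%:Z)
    + (j%:Z - k%:Z) * (j%:Z - k%:Z) + k%:Z * k%:Z = 2.
  by rewrite -[RHS](addr0 2) -[X in 2 + X](mulr0 2) -e0; ring.
have [|h1 [h2 h3]] := @sum3_le2 (2 * i%:Z + 2 - j%:Z) (j%:Z - k%:Z) k%:Z.
  by rewrite h.
have hs := h; rewrite h1 h2 h3 in h.
have : (i = 0 /\ j = 1 /\ k = 0 \/ i = 0 /\ j = 1 /\ k = 1 \/ i = 0 /\ j = 2 /\ k = 1)%N.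
  by have := sqr_lower_bound 2 (2 * i%:Z + 2 - j%:Z);
     have := sqr_lower_bound 2 (j%:Z - k%:Z); have := sqr_lower_bound 2 k%:Z; lia.
by case=> [|[]] [-> [-> ->]]; rewrite !inE !xpair_eqE.
Qed.

Let has_sum_indic (f : nat * nat * nat -> K) (A : {fset nat * nat * nat}) :
  (forall x, f x = (x \in A)%:R) -> has_sum f (#|` A|)%:R.
Proof.
move=> fA; have -> : (#|` A|)%:R = \sum_(x <- A) f x.
  rewrite (eq_big_seq (fun=> 1)) => [|x xA]; last by rewrite fA xA.
  by rewrite big_const_seq count_predT iter_addr_0.
by apply: has_sum_finite => x xA; rewrite fA (negbTE xA).
Qed.

Lemma has_sum_even0 : has_sum (summand_even (0 : K))
  (3 * (J (0 : K) 3 ^+ 3 * Jbar (0 : K) 4 12 / (J (0 : K) 1 * J (0 : K) 2 ^+ 2 * J (0 : K) 6))).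
Proof.
rewrite /J /Jbar /qpochs_inf !big_cons big_nil !Qn0 oppr0 exp0.
rewrite (_ : 12%:Z - 4%:Z == 0 = false)// oppr0 qpoch_inf_0 !expr1n !mulr1 divr1 mulr1.
have -> : 3 = (#|` A_even|)%:R :> K by rewrite /A_even fsetUC !cardfsU1 !inE cardfs1.
exact: has_sum_indic summand_even0.
Qed.

Lemma has_sum_odd0 : has_sum (summand_odd (0 : K))
  (3 * (J (0 : K) 3 ^+ 3 * Jbar (0 : K) 2 12 / (J (0 : K) 1 * J (0 : K) 2 ^+ 2 * J (0 : K) 6))).
Proof.
rewrite /J /Jbar /qpochs_inf !big_cons big_nil !Qn0 oppr0 exp0.
rewrite (_ : 12%:Z - 2%:Z == 0 = false)// oppr0 qpoch_inf_0 !expr1n !mulr1 divr1 mulr1.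
have -> : 3 = (#|` A_odd|)%:R :> K by rewrite /A_odd fsetUC !cardfsU1 !inE cardfs1.
exact: has_sum_indic summand_odd0.
Qed.

End Zero.
End Main.

(** * Absolutely summable families of complex numbers have sums *)

Section ComplexCompleteness.
Local Open Scope complex_scope.
Variable R : realType.

Lemma sup_real (I : choiceType) (f : I -> R) (M : R) : (forall i, 0 <= f i) ->
  (forall A : {fset I}, \sum_(i <- A) f i <= M) -> exists l, forall e, 0 < e ->
    exists A : {fset I}, forall B : {fset I}, (A `<=` B)%fset ->
      `|l - \sum_(i <- B) f i| < e.
Proof.
move=> f0 hM; pose S := [set \sum_(i <- A) f i | A in [set: {fset I}]].
have hS : has_sup S.
  split; first by exists (\sum_(i <- fset0) f i), fset0.
  by exists M => _ [A _ <-].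
exists (sup S) => e e0; have [_ [A _ <-] hA] := sup_adherent e0 hS.
exists A => B AB; have le1 : \sum_(i <- B) f i <= sup S.
  by apply: sup_upper_bound => //; exists B.
rewrite ger0_norm ?subr_ge0// ltrBlDr -ltrBlDl.
by apply: lt_le_trans hA _; apply: le_sum_fset.
Qed.

(** The family is the difference of the nonnegative families [f + |f|] and [|f|], each summed by a
    supremum. *)
Let sum_signed (I : choiceType) (f : I -> R) (M : R) :
  (forall A : {fset I}, \sum_(i <- A) `|f i| <= M) -> exists l, forall e, 0 < e ->
    exists A : {fset I}, forall B : {fset I}, (A `<=` B)%fset ->
      `|l - \sum_(i <- B) f i| < e.
Proof.
move=> hM; have [l1 h1] := sup_real (fun i => normr_ge0 (f i)) hM.
have [i|A|l2 h2] := @sup_real I (fun i => f i + `|f i|) (M + M).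
- by rewrite -lerBlDl sub0r -normrN ler_norm.
- rewrite big_split/= lerD//; apply: le_trans (hM A).
  by apply: ler_sum => i _; apply: ler_norm.
exists (l2 - l1) => e e0; have e20 : 0 < e / 2 by rewrite divr_gt0.
have [A hA] := h1 _ e20; have [B hB] := h2 _ e20.
exists (A `|` B)%fset => S; rewrite fsubUset => /andP[/hA + /hB].
set s1 := \sum_(i <- S) `|f i|; rewrite big_split/= -/s1 => hs1 hs2.
set s := \sum_(i <- S) f i in hs2 *.
have -> : l2 - l1 - s = (l2 - (s + s1)) - (l1 - s1) by ring.
by rewrite (le_lt_trans (ler_normB _ _))// [e]splitr ltrD.
Qed.

Let normcR (x : R) : `|x%:C| = `|x|%:C.
Proof. by rewrite normc_def /= expr0n/= addr0 sqrtr_sqr. Qed.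

Let has_sum_real (I : choiceType) (f : I -> R) (M : R) :
  (forall A : {fset I}, \sum_(i <- A) `|f i| <= M) ->
  exists l : R, has_sum (fun i => (f i)%:C) l%:C.
Proof.
move=> /sum_signed[l hl]; exists l; apply/has_sumP => e.
(* In the order of [R[i]], [0 < e] forces [e] to have imaginary part 0, so a real tolerance
   suffices. *)
rewrite ltcE /= => /andP[/eqP ie e0]; have [A hA] := hl _ e0.
exists A => B /hA; rewrite -rmorph_sum -rmorphB normcR ltcE /= ie eqxx.
by [].
Qed.

Lemma complex_abs_complete : abs_complete (R[i]).
Proof.
move=> I f [M hM].
have bound (g : R[i] -> R) : (forall x, `|g x|%:C <= `|x|) ->
    forall A : {fset I}, \sum_(i <- A) `|g (f i)| <= complex.Re M.
  move=> hg A; have : (\sum_(i <- A) `|g (f i)|)%:C <= M.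
    by apply: le_trans (hM A); rewrite rmorph_sum; apply: ler_sum => i _; apply: hg.
  by rewrite lecE => /andP[].
(* The bound for the imaginary part is that for the real part of [x * 'i]. *)
have hIm (x : R[i]) : `|complex.Im x|%:C <= `|x|.
  have := normc_ge_Re (x * 'i%C); rewrite ReiNIm normrN normrM.
  suff -> : `|'i%C : R[i]| = 1 by rewrite mulr1.
  by rewrite normc_def /= expr0n /= expr1n add0r sqrtr1.
have [a ha] := has_sum_real (bound _ (@normc_ge_Re R)).
have [b hb] := has_sum_real (bound _ hIm).
exists (a%:C + 'i%C * b%:C); have := has_sumD ha (has_sumZ (c := 'i%C) hb).
rewrite (_ : (fun i => _) = f)//; apply/funext => i.
by rewrite [RHS]complexE.
Qed.

End ComplexCompleteness.

Theorem corollary5p2 (R : realType) (q : R[i]) (hq : `|q| < 1) :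
  has_sum (fun ijk : nat * nat * nat =>
      let: (i, j, k) := ijk in
      q ^ (2 * i%:Z ^+ 2 + j%:Z ^+ 2 + k%:Z ^+ 2 - 2 * i%:Z * j%:Z - j%:Z * k%:Z
           + 2 * i%:Z - j%:Z)
      / (qpoch (q ^+ 2) (q ^+ 2) (2 * i) * qpoch (q ^+ 2) (q ^+ 2) j
         * qpoch (q ^+ 2) (q ^+ 2) k))
    (3 * (J q 3 ^+ 3 * Jbar q 4 12 / (J q 1 * J q 2 ^+ 2 * J q 6)))
  /\
  has_sum (fun ijk : nat * nat * nat =>
      let: (i, j, k) := ijk in
      q ^ (2 * i%:Z ^+ 2 + j%:Z ^+ 2 + k%:Z ^+ 2 - 2 * i%:Z * j%:Z - j%:Z * k%:Z
           + 4 * i%:Z - 2 * j%:Z + 1)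
      / (qpoch (q ^+ 2) (q ^+ 2) (2 * i + 1) * qpoch (q ^+ 2) (q ^+ 2) j
         * qpoch (q ^+ 2) (q ^+ 2) k))
    (3 * (J q 3 ^+ 3 * Jbar q 2 12 / (J q 1 * J q 2 ^+ 2 * J q 6))).
Proof.
have [->|q0] := eqVneq q 0.
  by split; [exact: has_sum_even0|exact: has_sum_odd0].
have Kc := @complex_abs_complete R.
have Q1 : `|sqrtC q| < 1 by rewrite -(@expr_lt1 _ 2)// -normrX sqrtCK.
have Q0 : sqrtC q != 0 by rewrite sqrtC_eq0.
by rewrite -(sqrtCK q); split; [exact: has_sum_even|exact: has_sum_odd].
Qed.
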